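(* Let $m=2$ and consider the primal–dual pair $(P)$: $\sup\{c_1x_1+c_2x_2 : x_1A_1+x_2A_2\preceq B\}$ and $(D)$: $\inf\{B\bullet Y : A_i\bullet Y=c_i\ (i=1,2),\ Y\succeq 0\}$, where $A_1,A_2,B\in\mathcal S^n$, $c\in\mathbb R^2$. Assume the standing assumption below. Then $\operatorname{val}(P)<\operatorname{val}(D)$ if and only if $(P)$ has a reformulation of the form $$\sup\ c_2'x_2\quad\text{s.t.}\quad x_1A_1'+x_2A_2'\preceq B'=I_r\oplus 0_{n-r},$$ where, partitioning row/column indices into consecutive blocks $\mathcal I_1,\mathcal I_2,\mathcal I_3,\mathcal I_4$ of sizes $p,\ r-p,\ s,\ n-r-s$ (with $s\ge 0$): $A_1'=\Lambda\oplus 0$ with $\Lambda\in\mathcal S^p$ diagonal and positive definite; and $A_2'$ has blocks $A_2'(\mathcal I_1,\mathcal I_1),A_2'(\mathcal I_1,\mathcal I_2),A_2'(\mathcal I_1,\mathcal I_3)$ arbitrary, $A_2'(\mathcal I_1,\mathcal I_4)=M\neq 0$, $A_2'(\mathcal I_2,\mathcal I_2)=\Sigma$ diagonal, $A_2'(\mathcal I_2,\mathcal I_3)=0$, $A_2'(\mathcal I_2,\mathcal I_4)=0$, $A_2'(\mathcal I_3,\mathcal I_3)=-I_s$, $A_2'(\mathcal I_3,\mathcal I_4)=0$, $A_2'(\mathcal I_4,\mathcal I_4)=0$ (and symmetric counterparts); and $c_2'>0$ (the coefficient of $x_1$ in the objective is $0$).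
   Context: $\mathcal S^n$ is the space of $n\times n$ real symmetric matrices; $S\preceq T$ means $T-S$ is positive semidefinite; $S\bullet T=\operatorname{trace}(ST)$; $\operatorname{val}(\cdot)$ is the optimal value (with $\sup\emptyset=-\infty$, $\inf\emptyset=+\infty$). For general $m$, $(P)$ is $\sup\{c^Tx:\sum_{i=1}^m x_iA_i\preceq B\}$ and $(D)$ is $\inf\{B\bullet Y: A_i\bullet Y=c_i\ \forall i,\ Y\succeq 0\}$. A slack of $(P)$ is a matrix $Z=B-\sum_i x_iA_i\succeq 0$. Standing assumption: $(P)$ is feasible, $A_1,\dots,A_m,B$ are linearly independent, $B=I_r\oplus 0$ for some $0\le r<n$, and $B$ is a slack of maximum rank in $(P)$. Reformulating $(P),(D)$ means applying finitely many of the operations: (1) replace $B$ by $B+\lambda A_j$ for some $j$ and $\lambda\ne0$; (2) exchange $(A_i,c_i)$ and $(A_j,c_j)$, $i\ne j$; (3) replace $(A_i,c_i)$ by $\lambda(A_i,c_i)+\mu(A_j,c_j)$ with $j\neq i$, $\lambda\neq0$; (4) replace every $A_i$ by $T^TA_iT$ and $B$ by $T^TBT$ for an invertible $T$. The result is called a reformulation. *)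

(* Defs.v *)
From HB Require Import structures.
From mathcomp Require Import all_boot all_order all_algebra.
Set Implicit Arguments. Unset Strict Implicit. Unset Printing Implicit Defensive.
Import Order.TTheory GRing.Theory Num.Theory.
Local Open Scope ring_scope.

Section SDP.
Variable R : rcfType.

Definition symmetric_mx n (S : 'M[R]_n) : Prop := S^T = S.

Definition psd n (S : 'M[R]_n) : Prop :=
  symmetric_mx S /\ forall x : 'cV[R]_n, 0 <= (x^T *m S *m x) 0 0.

Definition psd_le n (S T : 'M[R]_n) : Prop := psd (T - S).

Definition mdot n (S T : 'M[R]_n) : R := \tr (S *m T).

Definition sdp_data m n := (('I_m -> 'M[R]_n) * 'M[R]_n * ('I_m -> R))%type.

Definition lin_comb m n (A : 'I_m -> 'M[R]_n) (x : 'I_m -> R) : 'M[R]_n :=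
  \sum_(i < m) x i *: A i.

Definition primal_feasible m n (A : 'I_m -> 'M[R]_n) (B : 'M[R]_n) (x : 'I_m -> R) :=
  psd_le (lin_comb A x) B.

Definition dual_feasible m n (A : 'I_m -> 'M[R]_n) (c : 'I_m -> R) (Y : 'M[R]_n) :=
  psd Y /\ forall i, mdot (A i) Y = c i.

Definition primal_obj m (c : 'I_m -> R) (x : 'I_m -> R) : R := \sum_(i < m) c i * x i.

(* val(P) < val(D), with val(P) = sup (sup of empty = -oo) and
   val(D) = inf (inf of empty = +oo), compared as Dedekind cuts:
   some a < b separates all primal objective values from all dual ones. *)
Definition val_P_lt_val_D m n (A : 'I_m -> 'M[R]_n) (B : 'M[R]_n) (c : 'I_m -> R) :=
  exists a b : R, a < b /\
    (forall x, primal_feasible A B x -> primal_obj c x <= a) /\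
    (forall Y, dual_feasible A c Y -> b <= mdot B Y).

Definition is_slack m n (A : 'I_m -> 'M[R]_n) (B Z : 'M[R]_n) :=
  exists x, Z = B - lin_comb A x /\ psd Z.

Definition lin_indep m n (A : 'I_m -> 'M[R]_n) (B : 'M[R]_n) :=
  forall (mu : 'I_m -> R) (nu : R),
    lin_comb A mu + nu *: B = 0 -> nu = 0 /\ forall i, mu i = 0.

Definition standing_assumption m n (A : 'I_m -> 'M[R]_n) (B : 'M[R]_n) (r : nat) :=
  (exists x, primal_feasible A B x) /\
  lin_indep A B /\
  (r < n)%N /\ B = pid_mx r /\
  is_slack A B B /\
  (forall Z, is_slack A B Z -> (\rank Z <= \rank B)%N).

Inductive reform_step m n : sdp_data m n -> sdp_data m n -> Prop :=
| RS_shiftB (A : 'I_m -> 'M[R]_n) B c (j : 'I_m) (lam : R) :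
    lam != 0 -> reform_step (A, B, c) (A, B + lam *: A j, c)
| RS_swap (A : 'I_m -> 'M[R]_n) B c (i j : 'I_m) :
    i != j ->
    reform_step (A, B, c)
      ((fun k => if k == i then A j else if k == j then A i else A k), B,
       (fun k => if k == i then c j else if k == j then c i else c k))
| RS_comb (A : 'I_m -> 'M[R]_n) B c (i j : 'I_m) (lam mu : R) :
    j != i -> lam != 0 ->
    reform_step (A, B, c)
      ((fun k => if k == i then lam *: A i + mu *: A j else A k), B,
       (fun k => if k == i then lam * c i + mu * c j else c k))
| RS_congr (A : 'I_m -> 'M[R]_n) B c (T : 'M[R]_n) :
    T \in unitmx ->
    reform_step (A, B, c) ((fun k => T^T *m A k *m T), T^T *m B *m T, c).

Inductive reformulation m n : sdp_data m n -> sdp_data m n -> Prop :=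
| Reform_refl d : reformulation d d
| Reform_step d1 d2 d3 : reform_step d1 d2 -> reformulation d2 d3 -> reformulation d1 d3.

Definition i1 : 'I_2 := ord0.
Definition i2 : 'I_2 := ord_max.

Definition in_blk n (lo hi : nat) (i : 'I_n) : bool := (lo <= i)%N && (i < hi)%N.

Definition blk_zero n (X : 'M[R]_n) (I J : pred 'I_n) : Prop :=
  forall i j, I i -> J j -> X i j = 0 /\ X j i = 0.

Definition gap_form n (r : nat) (d : sdp_data 2 n) : Prop :=
  let: (A', B', c') := d in
  exists p s : nat, (p <= r)%N /\ (r + s <= n)%N /\
  let I1 := in_blk 0 p in
  let I2 := in_blk p r in
  let I3 := in_blk r (r + s) in
  let I4 := in_blk (r + s) n in
  let A1 := A' i1 in
  let A2 := A' i2 in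
  B' = pid_mx r /\
  (forall i j : 'I_n, A1 i j = if (i == j) && I1 i then A1 i i else 0) /\
  (forall i : 'I_n, I1 i -> 0 < A1 i i) /\
  (exists i j : 'I_n, I1 i /\ I4 j /\ A2 i j != 0) /\
  (forall i j : 'I_n, I2 i -> I2 j -> i != j -> A2 i j = 0) /\
  blk_zero A2 I2 I3 /\ blk_zero A2 I2 I4 /\
  (forall i j : 'I_n, I3 i -> I3 j -> A2 i j = if i == j then -1 else 0) /\
  blk_zero A2 I3 I4 /\ blk_zero A2 I4 I4 /\
  c' i1 = 0 /\ 0 < c' i2.

End SDP.

(* Main.v *)
(** The pair is normalised to [c = (0, 1)], so that the dual constraints read
    [A1 . Y = 0] and [A2 . Y = 1].  Suppose [val P <= a < b <= val D].

    If [A1] were indefinite, Finsler's lemma applied to [A1] and [A2 - B / b]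
    would give [t] with [A2 - B / b + t A1 <= 0], that is a primal feasible point
    with value [b > a].  Hence [A1] is semidefinite, positive semidefinite up to
    its sign; then [B + A1] is a slack, and the maximal rank of [B] confines [A1]
    to the leading block.  Diagonalising [A1] there shows that the dual lives on
    [I2], [I3], [I4].  The gap forces [A2 (I3 + I4, I3 + I4)] to be negative
    semidefinite and [A2 (I2, I4)] to vanish, since otherwise dual solutions with
    value below [b] would exist; an orthogonal and a triangular congruence give
    the normal form.  If [M] were zero, then, for [a < x2 < b] and [x1] very
    negative, [x1 A1 + x2 A2 <= B], which contradicts [val P <= a].

    Compactness is not available over a real closed field.  Finsler's lemma is
    proved algebraically: either some matrix [G] with [J G <> 0] is isotropic
    for both forms, and stationarity at [G] determines [t], or the two forms are
    simultaneously diagonalisable. *)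
Require Import Defs.
From HB Require Import structures.
From mathcomp Require Import all_boot all_order all_algebra.
From mathcomp Require Import complex ring lra zify.
From Stdlib Require Import Classical.
Set Implicit Arguments. Unset Strict Implicit. Unset Printing Implicit Defensive.
Import Order.TTheory GRing.Theory Num.Theory.
Local Open Scope ring_scope.

(** * Trace forms *)

Section Forms.
Variable R : rcfType.

(** [G] may have any number of columns: [qtr S G] is the inner product of [S] with [G *m G^T], so
    ranging over all [G] means ranging over all positive semidefinite matrices, and [row_mx]
    realises their sums. *)
Definition btr n m (S : 'M[R]_n) (G H : 'M[R]_(n, m)) : R := \tr (G^T *m S *m H).
Definition qtr n m (S : 'M[R]_n) (G : 'M[R]_(n, m)) : R := btr S G G.

Lemma btrC n m (S : 'M[R]_n) (G H : 'M[R]_(n, m)) :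
  symmetric_mx S -> btr S G H = btr S H G.
Proof.
by move=> sS; rewrite /btr -mxtrace_tr !trmx_mul trmxK sS mulmxA.
Qed.

Lemma btrDr n m (S : 'M[R]_n) (G H K : 'M[R]_(n, m)) :
  btr S G (H + K) = btr S G H + btr S G K.
Proof. by rewrite /btr mulmxDr mxtraceD. Qed.

Lemma btrDl n m (S : 'M[R]_n) (G H K : 'M[R]_(n, m)) :
  btr S (G + H) K = btr S G K + btr S H K.
Proof. by rewrite /btr linearD /= !mulmxDl mxtraceD. Qed.

Lemma btrZr n m (S : 'M[R]_n) a (G H : 'M[R]_(n, m)) :
  btr S G (a *: H) = a * btr S G H.
Proof. by rewrite /btr -scalemxAr mxtraceZ. Qed.

Lemma btrZl n m (S : 'M[R]_n) a (G H : 'M[R]_(n, m)) :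
  btr S (a *: G) H = a * btr S G H.
Proof. by rewrite /btr linearZ /= -!scalemxAl mxtraceZ. Qed.

Lemma qtrD n m (S : 'M[R]_n) (G H : 'M[R]_(n, m)) :
  symmetric_mx S -> qtr S (G + H) = qtr S G + 2 * btr S G H + qtr S H.
Proof.
by move=> sS; rewrite /qtr btrDl !btrDr (btrC H) //; ring.
Qed.

Lemma qtrZ n m (S : 'M[R]_n) a (G : 'M[R]_(n, m)) :
  qtr S (a *: G) = a ^+ 2 * qtr S G.
Proof. by rewrite /qtr btrZl btrZr mulrA expr2. Qed.

Lemma qtrDm n m (S T : 'M[R]_n) (G : 'M[R]_(n, m)) :
  qtr (S + T) G = qtr S G + qtr T G.
Proof. by rewrite /qtr /btr mulmxDr mulmxDl mxtraceD. Qed.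

Lemma qtrZm n m a (S : 'M[R]_n) (G : 'M[R]_(n, m)) :
  qtr (a *: S) G = a * qtr S G.
Proof. by rewrite /qtr /btr -scalemxAr -scalemxAl mxtraceZ. Qed.

Lemma qtrNm n m (S : 'M[R]_n) (G : 'M[R]_(n, m)) : qtr (- S) G = - qtr S G.
Proof. by rewrite -scaleN1r qtrZm mulN1r. Qed.

Lemma qtr_congr n k m (S : 'M[R]_n) (T : 'M[R]_(n, k)) (G : 'M[R]_(k, m)) :
  qtr (T^T *m S *m T) G = qtr S (T *m G).
Proof. by rewrite /qtr /btr trmx_mul !mulmxA. Qed.

Lemma qtr_row n m1 m2 (S : 'M[R]_n) (G : 'M[R]_(n, m1)) (H : 'M[R]_(n, m2)) :
  qtr S (row_mx G H) = qtr S G + qtr S H.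
Proof. by rewrite /qtr /btr tr_row_mx mul_col_mx mul_col_row mxtrace_block. Qed.

Lemma qtr_col n m (S : 'M[R]_n) (G : 'M[R]_(n, m)) :
  qtr S G = \sum_j qtr S (col j G).
Proof.
rewrite /qtr /btr /mxtrace; apply: eq_bigr => j _.
rewrite big_ord1 !mxE; apply: eq_bigr => k _; rewrite !mxE; congr (_ * _).
by apply: eq_bigr => l _; rewrite !mxE.
Qed.

Lemma qtr_tr n m (S : 'M[R]_n) (G : 'M[R]_(n, m)) :
  qtr S G = \tr (S *m (G *m G^T)).
Proof. by rewrite mulmxA [RHS]mxtrace_mulC mulmxA. Qed.

Lemma qtr_diag n (d : 'rV[R]_n) (x : 'cV[R]_n) :
  qtr (diag_mx d) x = \sum_i d 0 i * x i 0 ^+ 2.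
Proof.
rewrite /qtr /btr trace_mx11 mul_mx_diag mxE; apply: eq_bigr => i _.
by rewrite !mxE; ring.
Qed.

Lemma tr_selfmul n m (G : 'M[R]_(n, m)) :
  \tr (G^T *m G) = \sum_j \sum_i G i j ^+ 2.
Proof.
rewrite /mxtrace; apply: eq_bigr => j _; rewrite mxE.
by apply: eq_bigr => i _; rewrite mxE expr2.
Qed.

Lemma qtr_outer n m (S : 'M[R]_n) (v : 'cV[R]_n) (a : 'cV[R]_m) :
  qtr S (v *m a^T) = \tr (a^T *m a) * qtr S v.
Proof.
rewrite trace_mx11 !qtr_tr trmx_mul trmxK -!mulmxA [a^T *m (a *m _)]mulmxA.
by rewrite [a^T *m a in LHS]mx11_scalar mul_scalar_mx -!scalemxAr mxtraceZ.
Qed.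

Lemma tr_selfmul_ge0 n m (G : 'M[R]_(n, m)) : 0 <= \tr (G^T *m G).
Proof.
by rewrite tr_selfmul; do 2!(apply: sumr_ge0 => ? _); rewrite sqr_ge0.
Qed.

Lemma tr_selfmul_eq0 n m (G : 'M[R]_(n, m)) : \tr (G^T *m G) = 0 -> G = 0.
Proof.
rewrite tr_selfmul => /eqP; rewrite psumr_eq0; last first.
  by move=> j _; apply: sumr_ge0 => ? _; rewrite sqr_ge0.
move=> /allP h; apply/matrixP => i j; rewrite mxE.
have /h := mem_index_enum j; rewrite /= psumr_eq0 => [/allP h2|k _]; last exact: sqr_ge0.
by have /h2 /= := mem_index_enum i; rewrite sqrf_eq0 => /eqP.
Qed.

Lemma psdE n (S : 'M[R]_n) :
  psd S <-> symmetric_mx S /\ forall x : 'cV[R]_n, 0 <= qtr S x.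
Proof.
by split=> -[sS h]; split=> // x; have := h x; rewrite /qtr /btr trace_mx11.
Qed.

Lemma psd_qtr n m (S : 'M[R]_n) (G : 'M[R]_(n, m)) : psd S -> 0 <= qtr S G.
Proof. by move=> /psdE[_ h]; rewrite qtr_col sumr_ge0. Qed.

Lemma symmetric_congr n k (S : 'M[R]_n) (T : 'M[R]_(n, k)) :
  symmetric_mx S -> symmetric_mx (T^T *m S *m T).
Proof. by rewrite /symmetric_mx => sS; rewrite !trmx_mul trmxK sS mulmxA. Qed.

Lemma psd_congr n k (S : 'M[R]_n) (T : 'M[R]_(n, k)) :
  psd S -> psd (T^T *m S *m T).
Proof.
move=> /psdE[sS h]; apply/psdE; split; first exact: symmetric_congr.
by move=> x; rewrite qtr_congr.
Qed.

Lemma psd_gram n m (G : 'M[R]_(n, m)) : psd (G *m G^T).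
Proof.
apply/psdE; split; first by rewrite /symmetric_mx trmx_mul trmxK.
move=> x; have := tr_selfmul_ge0 (G^T *m x).
by rewrite /qtr /btr trmx_mul trmxK !mulmxA.
Qed.

Lemma symmetric_lin n (S T : 'M[R]_n) a b :
  symmetric_mx S -> symmetric_mx T -> symmetric_mx (a *: S + b *: T).
Proof. by rewrite /symmetric_mx => sS sT; rewrite linearD !linearZ /= sS sT. Qed.

(** For small [e] of the sign of [b] the linear term wins; [e = b / (1 + |c|)] is already small
    enough. *)
Lemma linear_coef_eq0 (b c : R) :
  (forall e, 2 * e * b + e ^+ 2 * c <= 0) -> b = 0.
Proof.
move=> h; apply/eqP/negPn/negP => b0.
pose t := (1 + `|c|)^-1.
have c1 : 0 < 1 + `|c| by rewrite ltr_wpDr.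
have tp : 0 < t by rewrite invr_gt0.
have tc : - 1 <= t * c.
  have : - (t * `|c|) <= t * c by rewrite -mulrN ler_pM2l // lerNl ler_normr lexx orbT.
  have : t * `|c| <= 1 by rewrite mulrC ler_pdivrMr // mul1r lerDr.
  by lra.
have := h (b * t).
have -> : 2 * (b * t) * b + (b * t) ^+ 2 * c = (b ^+ 2 * t) * (2 + t * c) by ring.
rewrite leNgt => /negP; apply; apply: mulr_gt0; last by lra.
by rewrite mulr_gt0 // exprn_even_gt0.
Qed.

(** This replaces letting [e] tend to 0. Adding the inequalities at [e] and [- e] cancels the linear
    term, and for [e = a / (a + |c|)] the quadratic term is too small to offset [a]. *)
Lemma const_coef_le0 (a b c : R) :
  (forall e, e != 0 -> a + 2 * e * b + e ^+ 2 * c <= 0) -> a <= 0.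
Proof.
move=> h; rewrite leNgt; apply/negP => a0.
pose e := a / (a + `|c|).
have ac : 0 < a + `|c| by rewrite ltr_wpDr.
have e0 : 0 < e by rewrite divr_gt0.
have e1 : e <= 1 by rewrite ler_pdivrMr // mul1r lerDl.
have h1 := h e (lt0r_neq0 e0).
have h2 : a + 2 * (- e) * b + (- e) ^+ 2 * c <= 0 by apply: h; rewrite oppr_eq0 lt0r_neq0.
have h3 : e * (a + `|c|) = a by rewrite divfK // lt0r_neq0.
have h4 : e ^+ 2 * - `|c| <= e ^+ 2 * c.
  by rewrite ler_wpM2l ?sqr_ge0 // lerNl ler_normr lexx orbT.
have h5 : e * (e * `|c|) <= e * `|c| by rewrite ler_piMl // mulr_ge0 // ltW.
have h6 : 0 < e * a by rewrite mulr_gt0.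
by lra.
Qed.

(** [G] minimises the form, so the first variation there vanishes; in the direction [S *m G] it is
    proportional to the squared Frobenius norm of [S *m G]. *)
Lemma psd_form0 n m (S : 'M[R]_n) (G : 'M[R]_(n, m)) :
  psd S -> qtr S G = 0 -> S *m G = 0.
Proof.
move=> pS h; have [sS _] := pS; apply: tr_selfmul_eq0.
suff : btr S (S *m G) G = 0 by rewrite /btr mulmxA.
rewrite btrC //; apply: (@linear_coef_eq0 _ (- qtr S (S *m G))) => e.
have := psd_qtr (G + (- e) *: (S *m G)) pS.
by rewrite qtrD // h qtrZ btrZr; lra.
Qed.

End Forms.

(** * Simultaneous diagonalization *)

Section SimDiag.
Variable R : rcfType.

(** The two equations are the real and imaginary parts of [C z = mu J z] with [z = x + i y] and
    [mu = a + i b]. Such a [z] is a row eigenvector of [C J^-1] over the algebraically closed field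
    [R[i]], transposed by symmetry. *)
Lemma pencil_eigenvector n (J C : 'M[R]_n) :
  (0 < n)%N -> symmetric_mx J -> symmetric_mx C -> J \in unitmx ->
  exists (a b : R) (x y : 'cV[R]_n), [/\ (x != 0) || (y != 0),
    C *m x = a *: (J *m x) - b *: (J *m y) &
    C *m y = b *: (J *m x) + a *: (J *m y)].
Proof.
move=> n0 sJ sC uJ; pose toC := map_mx (real_complex R) : 'M[R]_n -> 'M[R[i]]_n.
have [mu /eigenvalueP[z zE z0]] := eigenvalue_closed (toC (C *m invmx J)) n0.
have {}zE : z *m toC C = mu *: (z *m toC J).
  rewrite scalemxAl -zE -mulmxA -map_mxM.
  by rewrite -mulmxA mulVmx // mulmx1.
pose re (w : 'rV[R[i]]_n) : 'rV[R]_n := map_mx (@complex.Re R) w.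
pose im (w : 'rV[R[i]]_n) : 'rV[R]_n := map_mx (@complex.Im R) w.
have reM (w : 'rV[R[i]]_n) (S : 'M[R]_n) : re (w *m toC S) = re w *m S.
  apply/matrixP => i j; rewrite !mxE (raddf_sum (@complex.Re R : Rcomplex R -> R)).
  by apply: eq_bigr => k _; rewrite !mxE; case: (w i k) => u v /=; ring.
have imM (w : 'rV[R[i]]_n) (S : 'M[R]_n) : im (w *m toC S) = im w *m S.
  apply/matrixP => i j; rewrite !mxE (raddf_sum (@complex.Im R : Rcomplex R -> R)).
  by apply: eq_bigr => k _; rewrite !mxE; case: (w i k) => u v /=; ring.
have trS (S : 'M[R]_n) (w : 'rV[R]_n) : symmetric_mx S -> S *m w^T = (w *m S)^T.
  by move=> sS; rewrite trmx_mul sS.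
exists (complex.Re mu), (complex.Im mu), (re z)^T, (im z)^T; split.
- rewrite -negb_and; apply: contra z0 => /andP[/eqP hx /eqP hy].
  apply/eqP/matrixP => i j; rewrite mxE (ord1 i).
  move/matrixP/(_ j 0): hx; move/matrixP/(_ j 0): hy; rewrite !mxE.
  by case: (z 0 j) => u v /= -> ->.
- rewrite !trS // -(reM z C) zE -reM -imM.
  by apply/matrixP => i j; rewrite !mxE; case: (mu) (\sum_(_ < _) _) => [? ?] [? ?].
- rewrite !trS // -(imM z C) zE -reM -imM.
  apply/matrixP => i j; rewrite !mxE; case: (mu) (\sum_(_ < _) _) => [? ?] [? ?] /=; ring.
Qed.

(** This takes the place of definiteness: it holds when [J] is positive definite, is inherited by
    restriction to any subspace, and suffices for simultaneous diagonalization. *)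
Definition split_pencil n (J C : 'M[R]_n) :=
  forall m (G : 'M[R]_(n, m)), qtr J G = 0 -> qtr C G = 0 -> J *m G = 0 /\ C *m G = 0.

Lemma split_pencil_congr n k (J C : 'M[R]_n) (T : 'M[R]_(n, k)) :
  split_pencil J C -> split_pencil (T^T *m J *m T) (T^T *m C *m T).
Proof.
move=> h m G; rewrite !qtr_congr => hJ hC; have [h1 h2] := h _ _ hJ hC.
by rewrite -!mulmxA h1 h2 !mulmx0.
Qed.

(* Either the kernel of [J] or a real eigenvector of [J^-1 C] provides [x]; a
   nonreal eigenvector [x + i y] would make [qtr J] and [qtr C] vanish on [x y]. *)
Lemma split_off_vector n (J C : 'M[R]_n) :
  (0 < n)%N -> symmetric_mx J -> symmetric_mx C -> split_pencil J C ->
  exists (x : 'cV[R]_n) (phi : 'rV[R]_n) (a c : R),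
    [/\ (phi *m x) 0 0 != 0, x^T *m J = a *: phi & x^T *m C = c *: phi].
Proof.
move=> n0 sJ sC h.
have trS (S : 'M[R]_n) (w : 'cV[R]_n) : symmetric_mx S -> w^T *m S = (S *m w)^T.
  by move=> sS; rewrite trmx_mul sS.
have nz (w : 'cV[R]_n) : w != 0 -> (w^T *m w) 0 0 != 0.
  apply: contra => /eqP; rewrite -trace_mx11 => /tr_selfmul_eq0 ->; exact: eqxx.
(* A real eigenvector suffices: if [qtr J x] is nonzero, take [phi = x^T J]; otherwise [x] lies in
   both kernels and [x^T] serves as [phi] with zero coefficients. *)
have onev (x : 'cV[R]_n) a : x != 0 -> C *m x = a *: (J *m x) ->
  exists (x : 'cV[R]_n) (phi : 'rV[R]_n) (a c : R),
    [/\ (phi *m x) 0 0 != 0, x^T *m J = a *: phi & x^T *m C = c *: phi].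
  move=> x0 Cx; have [Jx0|Jx0] := eqVneq (qtr J x) 0.
    have Cx0 : qtr C x = 0.
      by rewrite /qtr /btr -mulmxA Cx -scalemxAr mulmxA mxtraceZ -/(btr J x x) -/(qtr J x) Jx0 mulr0.
    have [Jx Cx'] := h _ _ Jx0 Cx0.
    exists x, x^T, 0, 0; rewrite !scale0r !trS // Jx Cx' !trmx0; split => //.
    exact: nz.
  exists x, (x^T *m J), 1, a; split.
  - by move: Jx0; rewrite /qtr /btr trace_mx11.
  - by rewrite scale1r.
  - by rewrite !trS // Cx linearZ.
have [uJ|/negP uJ] := boolP (J \in unitmx); last first.
  have /rowV0Pn[v /sub_kermxP vJ v0] : kermx J != 0.
    by rewrite kermx_eq0 row_free_unit; apply/negP.
  have Jx : J *m v^T = 0 by rewrite -[J in LHS]sJ -trmx_mul vJ trmx0.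
  have x0 : v^T != 0 by apply: contra v0 => /eqP e; rewrite -[v]trmxK e trmx0.
  have [Cx0|Cx0] := eqVneq (qtr C v^T) 0.
    have [//|_ Cx] := h _ v^T _ Cx0; first by rewrite /qtr /btr -mulmxA Jx mulmx0 mxtrace0.
    by apply: (@onev v^T 0) => //; rewrite Cx scale0r.
  exists v^T, (v^T^T *m C), 0, 1; split.
  - by move: Cx0; rewrite /qtr /btr trace_mx11.
  - by rewrite scale0r trS // Jx trmx0.
  - by rewrite scale1r.
have [a [b [x [y [xy Cx Cy]]]]] := pencil_eigenvector n0 sJ sC uJ.
have [b0|b0] := eqVneq b 0.
  move: Cx Cy; rewrite b0 !scale0r subr0 add0r => Cx Cy.
  by case/orP: xy => [x0|y0]; [apply: (onev x a)|apply: (onev y a)].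
have bC (u w : 'cV[R]_n) (S : 'M[R]_n) : btr S u w = \tr (u^T *m (S *m w)).
  by rewrite /btr mulmxA.
(* Computing [btr C x y] in both orders through the eigenvector equations gives
   [b * (qtr J x + qtr J y) = 0]. *)
have := btrC x y sC; rewrite !bC Cx Cy.
rewrite mulmxDr mulmxBr -!scalemxAr !mxtraceD !linearN /= !mxtraceZ -!bC (btrC y x) // -!/(qtr _ _) => e1.
have e2 : b * (qtr J x + qtr J y) = 0 by lra.
have qC : qtr C x + qtr C y = a * (qtr J x + qtr J y).
  rewrite -[qtr C x]/(btr C x x) -[qtr C y]/(btr C y y) !bC Cx Cy !mulmxDr mulmxN -!scalemxAr !mxtraceD !linearN /= !mxtraceZ -!bC.
  by rewrite (btrC y x) // -!/(qtr _ _); ring.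
have qJ : qtr J x + qtr J y = 0 by apply/eqP; move/eqP: e2; rewrite mulf_eq0 (negPf b0).
have [] := h _ (row_mx x y); rewrite ?qtr_row ?qC ?qJ ?mulr0 // => JG _.
have : row_mx x y = 0 by rewrite -[row_mx x y](mulKmx uJ) JG mulmx0.
rewrite -row_mx0 => /eq_row_mx[ex ey].
by move: xy; rewrite ex ey eqxx.
Qed.

Lemma complete_basis n (x : 'cV[R]_(1 + n)) (phi : 'rV[R]_(1 + n)) :
  (phi *m x) 0 0 != 0 ->
  exists K : 'M[R]_(1 + n, n), phi *m K = 0 /\ row_mx x K \in unitmx.
Proof.
move=> px.
have x0 : x != 0 by apply: contraNneq px => ->; rewrite mulmx0 mxE.
(* The first row of the invertible [E] spans the line of [x^T]; the other rows complete it to a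
   basis. *)
pose E := row_ebase x^T.
have [k xe] : exists k : R, x = k *: (usubmx E)^T.
  have r1 : \rank x^T = 1%N.
    by apply/eqP; rewrite eqn_leq rank_leq_row lt0n mxrank_eq0 -trmx0 (inj_eq trmx_inj).
  exists (col_ebase x^T 0 0); apply: trmx_inj.
  rewrite -[LHS](mulmx_ebase x^T) r1 [col_ebase x^T in LHS]mx11_scalar.
  rewrite -mulmxA mul_scalar_mx -/E linearZ /= trmxK.
  have -> : pid_mx 1 = row_mx 1%:M 0 :> 'M[R]_(1, 1 + n).
    by apply/matrixP => i j; rewrite !mxE (ord1 i); case: split_ordP => j' -> /[!mxE]; rewrite ?(ord1 j').
  by rewrite -[in LHS](vsubmxK E) mul_row_col mul1mx mul0mx addr0.
have k0 : k != 0 by apply: contraNneq x0 => k0; rewrite xe k0 scale0r.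
pose K0 : 'M[R]_(1 + n, n) := (dsubmx E)^T.
have uM : row_mx x K0 \in unitmx.
  have -> : row_mx x K0 = E^T *m block_mx k%:M 0 0 1%:M.
    rewrite -(vsubmxK E) tr_col_mx mul_row_block !mulmx0 mulmx1 addr0 add0r.
    by rewrite mul_mx_scalar -xe.
  rewrite unitmx_mul unitmx_tr row_ebase_unit unitmxE det_ublock det_scalar1 det1 mulr1.
  by rewrite unitfE.
pose f := (phi *m x) 0 0.
(* Projecting along [x] moves the columns of [K0] into the kernel of [phi] and changes the basis
   only by a unitriangular factor. *)
pose K := K0 - x *m (f^-1 *: (phi *m K0)).
exists K; split.
  rewrite mulmxBr mulmxA [phi *m x]mx11_scalar mul_scalar_mx scalerA divff //.
  by rewrite scale1r subrr.
have -> : row_mx x K = row_mx x K0 *m block_mx 1%:M (- (f^-1 *: (phi *m K0))) 0 1%:M.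
  by rewrite mul_row_block !mulmx0 !mulmx1 addr0 mulmxN addrC.
by rewrite unitmx_mul uM unitmxE det_ublock !det1 mulr1 unitr1.
Qed.

(** Since [x^T J] and [x^T C] are multiples of one [phi], the kernel of [phi] is orthogonal to [x]
    for both forms; the induction continues on a basis [K] of that kernel. *)
Lemma simultaneous_diagonalization n (J C : 'M[R]_n) :
  symmetric_mx J -> symmetric_mx C -> split_pencil J C ->
  exists (T : 'M[R]_n) (j c : 'rV[R]_n),
    [/\ T \in unitmx, T^T *m J *m T = diag_mx j & T^T *m C *m T = diag_mx c].
Proof.
elim: n J C => [|n IH] J C sJ sC h.
  exists 1%:M, 0, 0; rewrite unitmx1; split=> //; apply/matrixP; by case.
have [x [phi [a [c [px xJ xC]]]]] := split_off_vector (ltn0Sn n) sJ sC h.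
have [K [pK uK]] := @complete_basis n x phi px.
have [T [j [d [uT TJ TC]]]] := IH _ _ (symmetric_congr K sJ) (symmetric_congr K sC) (split_pencil_congr (T := K) h).
have diagE (S : 'M[R]_(1 + n)) k (e : 'rV[R]_n) : symmetric_mx S ->
    x^T *m S = k *: phi -> T^T *m (K^T *m S *m K) *m T = diag_mx e ->
    (row_mx x K *m block_mx 1%:M 0 0 T)^T *m S *m (row_mx x K *m block_mx 1%:M 0 0 T)
    = diag_mx (row_mx (qtr S x)%:M e).
  move=> sS xS TS; rewrite mul_row_block !mulmx0 mulmx1 addr0 add0r.
  rewrite tr_row_mx mul_col_mx mul_col_row diag_mx_row.
  have xK : x^T *m S *m (K *m T) = 0.
    by rewrite mulmxA xS -(scalemxAl k phi K) pK scaler0 mul0mx.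
  congr block_mx => //.
  - apply/matrixP => i' j'; rewrite (ord1 i') (ord1 j') /qtr /btr trace_mx11.
    by rewrite [RHS]mxE [in RHS]mxE eqxx !mulr1n.
  - by apply: trmx_inj; rewrite !trmx_mul !trmxK sS trmx0 -xK !mulmxA.
  - by rewrite -TS trmx_mul !mulmxA.
exists (row_mx x K *m block_mx 1%:M 0 0 T), (row_mx (qtr J x)%:M j), (row_mx (qtr C x)%:M d).
split.
- rewrite unitmx_mul uK /=.
  have : block_mx 1%:M 0 0 T \in (unitmx : {pred 'M[R]_(1 + n)}) by rewrite unitmxE det_ublock det1 mul1r -unitmxE.
  by [].
- exact: diagE xJ TJ.
- exact: diagE xC TC.
Qed.

End SimDiag.

(** * Finsler's lemma *)

Section Finsler.
Variables (R : rcfType) (n : nat) (J C : 'M[R]_n) (up un : 'cV[R]_n).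
Hypotheses (sJ : symmetric_mx J) (sC : symmetric_mx C).
Hypotheses (hup : 0 < qtr J up) (hun : qtr J un < 0).
Hypothesis H : forall m (G : 'M[R]_(n, m)), qtr J G = 0 -> qtr C G <= 0.

Lemma qtr_surjective (a : R) : exists u : 'cV[R]_n, qtr J u = a.
Proof.
have scaled (v : 'cV[R]_n) : qtr J v != 0 -> 0 <= a / qtr J v -> exists u : 'cV[R]_n, qtr J u = a.
  move=> v0 av; exists (Num.sqrt (a / qtr J v) *: v).
  by rewrite qtrZ sqr_sqrtr // divfK.
have [a0|a0] := leP 0 a.
  by apply: (scaled up); rewrite ?lt0r_neq0 // divr_ge0 // ltW.
apply: (scaled un); first by rewrite ltr0_neq0.
by rewrite -mulrNN -invrN mulr_ge0 ?invr_ge0 ?oppr_ge0 // ltW.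
Qed.

(** [G] maximises [qtr C] on the cone [qtr J = 0]. The extra column [e *: u] cancels the second
    order term [e ^+ 2 * qtr J V], so the perturbation stays exactly on the cone and the linear
    coefficient in [e] must vanish. *)
Lemma isotropic_stationary m (G V : 'M[R]_(n, m)) :
  qtr J G = 0 -> qtr C G = 0 -> btr J V G = 0 -> btr C V G = 0.
Proof.
move=> JG CG JVG; have [u Ju] := qtr_surjective (- qtr J V).
rewrite btrC //; apply: (@linear_coef_eq0 _ _ (qtr C V + qtr C u)) => e.
have := @H _ (row_mx (G + e *: V) (e *: u)).
rewrite !qtr_row !qtrD // !qtrZ !btrZr JG CG Ju (btrC G V sJ) JVG.
have -> : 0 + 2 * (e * 0) + e ^+ 2 * qtr J V + e ^+ 2 * - qtr J V = 0 by ring.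
by move=> /(_ erefl); lra.
Qed.

(** Lagrange multiplier rule: the functional [btr C _ G] vanishes on the kernel of [btr J _ G],
    hence is a multiple of it. *)
Lemma isotropic_eigen m (G : 'M[R]_(n, m)) :
  qtr J G = 0 -> qtr C G = 0 -> exists t, C *m G = - t *: (J *m G).
Proof.
move=> JG CG; pose N := \tr ((J *m G)^T *m (J *m G)).
have bE (S : 'M[R]_n) (V : 'M[R]_(n, m)) : btr S V G = \tr (V^T *m (S *m G)).
  by rewrite /btr mulmxA.
have [N0|N0] := eqVneq N 0.
  have JG0 := tr_selfmul_eq0 N0; exists 0; rewrite oppr0 scale0r.
  apply: tr_selfmul_eq0; rewrite -bE; apply: isotropic_stationary => //.
  by rewrite bE JG0 mulmx0 mxtrace0.
(* This coefficient makes [C *m G + t *: (J *m G)] orthogonal to [J *m G]. *)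
pose t := - (\tr ((J *m G)^T *m (C *m G)) / N).
exists t; pose D := C *m G + t *: (J *m G).
suff D0 : D = 0 by apply/eqP; rewrite scaleNr -addr_eq0; apply/eqP.
have Dtr V : \tr (V^T *m D) = 0.
  rewrite /D mulmxDr -scalemxAr mxtraceD mxtraceZ -!bE.
  pose k := btr J V G / N.
  have : btr C (V - k *: (J *m G)) G = 0.
    apply: isotropic_stationary => //.
    by rewrite -scaleNr btrDl btrZl [X in _ + _ * X]bE -/N /k; field.
  rewrite -scaleNr btrDl btrZl [X in _ + _ * X]bE => e.
  have -> : btr C V G = k * \tr ((J *m G)^T *m (C *m G)) by lra.
  by rewrite /k /t; field.
by apply: tr_selfmul_eq0; apply: Dtr.
Qed.

(** [D = C + t J] annihilates [G], so adding a multiple of [G] to the rank one matrix [v a^T]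
    restores [qtr J = 0] without changing the value of [D], and [H] gives the sign of [qtr D v].
    This needs [G^T J v] nonzero; the other [v] are approached along [v + e *: u]. *)
Lemma finsler_isotropic m (G : 'M[R]_(n, m)) :
  qtr J G = 0 -> qtr C G = 0 -> J *m G != 0 ->
  exists t, forall v : 'cV[R]_n, qtr C v + t * qtr J v <= 0.
Proof.
move=> JG CG JG0; have [t tE] := isotropic_eigen JG CG; exists t.
pose D := C + t *: J.
have sD : symmetric_mx D by have := symmetric_lin 1 t sC sJ; rewrite scale1r.
have DG : D *m G = 0 by rewrite mulmxDl tE -scalemxAl scaleNr addNr.
have qD k (F : 'M[R]_(n, k)) : qtr D F = qtr C F + t * qtr J F.
  by rewrite qtrDm qtrZm.
have generic (v : 'cV[R]_n) : G^T *m J *m v != 0 -> qtr D v <= 0.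
  set a := G^T *m J *m v => a0.
  pose nu := \tr (a^T *m a).
  have nu0 : 0 < nu.
    rewrite lt_neqAle tr_selfmul_ge0 eq_sym andbT.
    by apply: contra a0 => /eqP /tr_selfmul_eq0 ->.
  (* [qtr J F] will be [nu * qtr J v + 2 * tau * nu], which this value cancels. *)
  pose tau := - qtr J v / 2.
  pose F := v *m a^T + tau *: G.
  have qva S : qtr S (v *m a^T) = nu * qtr S v by exact: qtr_outer.
  have JF : qtr J F = 0.
    rewrite qtrD // qtrZ JG qva btrZr.
    have -> : btr J (v *m a^T) G = nu.
      rewrite btrC // /btr !mulmxA -/a mxtrace_mulC //.
    by rewrite /tau; field.
  have := H JF; suff -> : qtr C F = nu * qtr D v by rewrite pmulr_rle0.
  have -> : qtr C F = qtr D F by rewrite qD JF mulr0 addr0.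
  rewrite qtrD // qva btrZr qtrZ /qtr /btr -!mulmxA DG !mulmx0 mxtrace0; ring.
move=> v; rewrite -qD.
have [u u0] : exists u : 'cV[R]_n, G^T *m J *m u != 0.
  apply: NNPP => h; move/negP: JG0; apply; rewrite -trmx_eq0 trmx_mul sJ.
  apply/eqP/matrixP => i j; rewrite mxE.
  have : G^T *m J *m delta_mx j 0 = 0 :> 'cV[R]_m.
    by apply/eqP/negPn/negP => k; apply: h; exists (delta_mx j 0).
  by rewrite -colE => /matrixP/(_ i 0); rewrite !mxE.
have [v0|v0] := eqVneq (G^T *m J *m v) 0; last exact: generic.
apply: (@const_coef_le0 _ _ (btr D v u) (qtr D u)) => e e0.
have := generic (v + e *: u); rewrite qtrD // qtrZ btrZr.
rewrite mulmxDr v0 add0r -scalemxAr scaler_eq0 negb_or e0 u0 => /(_ isT).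
by lra.
Qed.

Lemma finsler_diagonal (j c : 'rV[R]_n) (T : 'M[R]_n) : T \in unitmx ->
  T^T *m J *m T = diag_mx j -> T^T *m C *m T = diag_mx c ->
  exists t, forall v : 'cV[R]_n, qtr C v + t * qtr J v <= 0.
Proof.
move=> uT TJ TC.
have TiK (v : 'cV[R]_n) : v = T *m (invmx T *m v) by rewrite mulmxA mulmxV ?mul1mx.
have qJ (x : 'cV[R]_n) : qtr J (T *m x) = \sum_i j 0 i * x i 0 ^+ 2.
  by rewrite -qtr_congr TJ qtr_diag.
have qC (x : 'cV[R]_n) : qtr C (T *m x) = \sum_i c 0 i * x i 0 ^+ 2.
  by rewrite -qtr_congr TC qtr_diag.
have sumdelta (d : 'rV[R]_n) a i : \sum_k d 0 k * (a *: delta_mx i 0 : 'cV[R]_n) k 0 ^+ 2 = a ^+ 2 * d 0 i.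
  rewrite (bigD1 i) //= big1 => [|k ki]; last by rewrite !mxE (negPf ki) mulr0 expr0n mulr0.
  by rewrite !mxE !eqxx mulr1 addr0 mulrC.
have [i0 ji0] : exists i, 0 < j 0 i.
  apply: NNPP => h; move: hup; rewrite (TiK up) qJ ltNge sumr_le0 // => i _.
  by rewrite mulr_le0_ge0 ?sqr_ge0 // leNgt; apply/negP => ?; apply: h; exists i.
(* Each index with [j 0 i] positive requires [t <= F i], so the minimum of [F] over these indices is
   the largest candidate for [t]. *)
pose F i := - (c 0 i / j 0 i).
case: (@arg_minP _ _ _ i0 (fun i => 0 < j 0 i) F ji0) => i ji imin.
exists (F i) => v; rewrite (TiK v) qJ qC mulr_sumr -big_split /= sumr_le0 // => k _.
rewrite mulrA -mulrDl mulr_le0_ge0 ?sqr_ge0 //.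
have [jk|jk|jk] := ltrgt0P (j 0 k).
- have := imin _ jk; rewrite /F -(ler_pM2r jk) mulNr [X in _ <= X]mulNr divfK ?lt0r_neq0 //.
  by lra.
(* The columns along [i] and [k] are weighted so that their [J] values, of opposite signs, cancel;
   [H] on this pair is the inequality wanted at [k]. *)
- have := @H _ (row_mx (T *m (Num.sqrt (- j 0 k) *: (delta_mx i 0 : 'cV_n))) (T *m (Num.sqrt (j 0 i) *: (delta_mx k 0 : 'cV_n)))).
  rewrite !qtr_row !qJ !qC !sumdelta !sqr_sqrtr ?oppr_ge0 ?(ltW jk) ?(ltW ji) //.
  have -> : - j 0 k * j 0 i + j 0 i * j 0 k = 0 by ring.
  move=> /(_ erefl) h; rewrite -(pmulr_rle0 _ ji).
  suff -> : j 0 i * (c 0 k + F i * j 0 k) = - j 0 k * c 0 i + j 0 i * c 0 k by [].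
  by rewrite /F; field; exact: lt0r_neq0.
- have := @H _ (T *m (1 *: (delta_mx k 0 : 'cV_n))).
  by rewrite qJ qC !sumdelta jk expr1n !mul1r mulr0 addr0; apply.
Qed.

Lemma finsler : exists t, forall v : 'cV[R]_n, qtr C v + t * qtr J v <= 0.
Proof.
have [[m [G [JG CG JG0]]]|h] :=
    classic (exists m (G : 'M[R]_(n, m)), [/\ qtr J G = 0, qtr C G = 0 & J *m G != 0]).
  exact: finsler_isotropic JG0.
(* In the absence of such a [G], every common isotropic matrix is killed by [J], and by the
   multiplier rule also by [C]: the pencil splits. *)
have [] := @simultaneous_diagonalization _ n J C sJ sC.
  move=> m G JG CG; have JG0 : J *m G = 0.
    by apply/eqP/negPn/negP => JG0; apply: h; exists m, G.
  by have [t ->] := isotropic_eigen JG CG; rewrite JG0 scaler0.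
by move=> T [j [c [uT TJ TC]]]; exact: finsler_diagonal TJ TC.
Qed.

End Finsler.

(** * Spectral consequences *)

Section Spectral.
Variable R : rcfType.

(** The condition on the kernel of [J] splits the pencil, so diagonal entries can be compared one by
    one. Its second half excludes [J = diag(1, 0)] with a nonzero off-diagonal [C], where no [t]
    exists. *)
Lemma psd_dominates n (J C : 'M[R]_n) :
  psd J -> symmetric_mx C ->
  (forall w : 'cV[R]_n, J *m w = 0 -> qtr C w <= 0 /\ (qtr C w = 0 -> C *m w = 0)) ->
  exists t, forall v : 'cV[R]_n, qtr C v <= t * qtr J v.
Proof.
move=> pJ sC h; have [sJ _] := pJ.
have [] := @simultaneous_diagonalization _ n J C sJ sC.
  move=> m G JG CG; have JG0 := psd_form0 pJ JG; split=> //.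
  have Jcol j : J *m col j G = 0 by rewrite colE mulmxA JG0 mul0mx.
  move: CG; rewrite qtr_col => /eqP; rewrite -oppr_eq0 -sumrN psumr_eq0; last first.
    by move=> j _; rewrite oppr_ge0; have [] := h _ (Jcol j).
  move=> /allP e; apply/matrixP => i j; rewrite [RHS]mxE.
  have /e := mem_index_enum j; rewrite oppr_eq0 => /eqP /(proj2 (h _ (Jcol j))).
  by rewrite colE mulmxA -colE => /matrixP/(_ i 0); rewrite !mxE.
move=> T [j [c [uT TJ TC]]].
have TiK (v : 'cV[R]_n) : v = T *m (invmx T *m v) by rewrite mulmxA mulmxV ?mul1mx.
have qJ (x : 'cV[R]_n) : qtr J (T *m x) = \sum_i j 0 i * x i 0 ^+ 2.
  by rewrite -qtr_congr TJ qtr_diag.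
have qC (x : 'cV[R]_n) : qtr C (T *m x) = \sum_i c 0 i * x i 0 ^+ 2.
  by rewrite -qtr_congr TC qtr_diag.
have qd (d : 'rV[R]_n) i : \sum_k d 0 k * (delta_mx i 0 : 'cV[R]_n) k 0 ^+ 2 = d 0 i.
  rewrite (bigD1 i) //= big1 => [|k ki]; last by rewrite !mxE (negPf ki) expr0n mulr0.
  by rewrite !mxE !eqxx expr1n mulr1 addr0.
have j0 i : 0 <= j 0 i by rewrite -(qd j i) -qJ psd_qtr.
(* Each ratio handles one coordinate; an index with [j 0 i = 0] contributes 0, since the inverse of
   0 is 0. *)
pose t := \sum_i `|c 0 i| / j 0 i.
exists t => v; rewrite (TiK v) qJ qC mulr_sumr ler_sum // => i _.
rewrite mulrA ler_wpM2r ?sqr_ge0 //.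
have [ji|ji] := eqVneq (j 0 i) 0.
  rewrite ji mulr0 -(qd c i) -qC; apply: (proj1 (h _ _)).
  by apply: psd_form0 => //; rewrite qJ qd.
have ji0 : 0 < j 0 i by rewrite lt_neqAle eq_sym ji j0.
apply: le_trans (ler_norm _) _; rewrite -ler_pdivrMr // /t (bigD1 i) //= lerDl.
by apply: sumr_ge0 => k _; rewrite divr_ge0.
Qed.

(** Diagonalise the pair [1%:M], [S], then rescale the columns of [T] to unit norm. *)
Lemma spectral n (S : 'M[R]_n) : symmetric_mx S ->
  exists (U : 'M[R]_n) (d : 'rV[R]_n), U^T *m U = 1%:M /\ U^T *m S *m U = diag_mx d.
Proof.
move=> sS; have [] := @simultaneous_diagonalization _ n 1%:M S _ sS.
- by rewrite /symmetric_mx trmx1.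
- move=> m G; rewrite /qtr /btr mulmx1 => /tr_selfmul_eq0 -> _.
  by rewrite !mulmx0.
move=> T [j [c [uT]]]; rewrite mulmx1 => TT TS.
have jE i : j 0 i = \sum_k T k i ^+ 2.
  move/matrixP/(_ i i): TT; rewrite !mxE eqxx mulr1n => <-.
  by apply: eq_bigr => k _; rewrite !mxE expr2.
have j0 i : 0 < j 0 i.
  rewrite lt_neqAle jE sumr_ge0 ?andbT => [|k _]; last exact: sqr_ge0.
  apply/eqP => /esym/eqP; rewrite psumr_eq0 => [/allP e|k _]; last exact: sqr_ge0.
  have Ti : T *m delta_mx i 0 = 0 :> 'cV[R]_n.
    apply/matrixP => k l; rewrite -colE !mxE; apply/eqP; rewrite -sqrf_eq0.
    by apply: e; apply: mem_index_enum.
  have : (invmx T *m (T *m delta_mx i 0) : 'cV[R]_n) i 0 = 0 by rewrite Ti mulmx0 mxE.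
  by rewrite mulKmx // mxE !eqxx => /eqP; rewrite oner_eq0.
pose s := \row_i (Num.sqrt (j 0 i))^-1 : 'rV[R]_n.
exists (T *m diag_mx s), (\row_i (c 0 i / j 0 i)).
have conj (M : 'M[R]_n) d : T^T *m M *m T = diag_mx d ->
    (T *m diag_mx s)^T *m M *m (T *m diag_mx s) = diag_mx (\row_i (d 0 i / j 0 i)).
  move=> e; rewrite trmx_mul tr_diag_mx -!mulmxA [M *m (T *m _)]mulmxA [T^T *m _]mulmxA mulmxA.
  rewrite [T^T *m (M *m T)]mulmxA e -mulmxA.
  rewrite !mulmx_diag; congr diag_mx; apply/rowP => k; rewrite !mxE.
  have sj := sqr_sqrtr (ltW (j0 k)).
  have s0 : Num.sqrt (j 0 k) != 0 by rewrite lt0r_neq0 // sqrtr_gt0.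
  by rewrite -[j 0 k in RHS]sj; field.
split; last exact: conj.
rewrite -[X in X *m _]mulmx1 (conj _ j) ?mulmx1 //.
apply/matrixP => k l; rewrite !mxE; case: eqVneq => // _.
by rewrite divff ?lt0r_neq0.
Qed.

Lemma psd_spectral n (S : 'M[R]_n) : psd S ->
  exists p q (U : 'M[R]_(n, p + q)) (d : 'rV[R]_p),
    [/\ (p + q)%N = n, U^T *m U = 1%:M, forall i, 0 < d 0 i &
        U^T *m S *m U = block_mx (diag_mx d) 0 0 0].
Proof.
move=> pS; have [sS _] := pS; have [U [d [UU US]]] := spectral sS.
have d0 i : 0 <= d 0 i.
  have := psd_qtr (U *m (delta_mx i 0 : 'cV[R]_n)) pS.
  rewrite -qtr_congr US qtr_diag (bigD1 i) //= big1 => [|k ki]; last first.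
    by rewrite !mxE (negPf ki) expr0n mulr0.
  by rewrite !mxE !eqxx expr1n mulr1 addr0.
pose P := [set i | 0 < d 0 i].
(* [f] lists the positive eigenvalues first, then the zero ones. *)
pose f (i : 'I_(#|P| + #|~: P|)) : 'I_n :=
  match split i with inl a => enum_val a | inr b => enum_val b end.
have fl a : f (lshift _ a) = enum_val a by rewrite /f (unsplitK (inl _ a)).
have fr b : f (rshift _ b) = enum_val b by rewrite /f (unsplitK (inr _ b)).
have dl a : 0 < d 0 (f (lshift _ a)) by rewrite fl; have := enum_valP a; rewrite inE.
have dr b : d 0 (f (rshift _ b)) = 0.
  rewrite fr; have := enum_valP b; rewrite !inE -leNgt => h.
  by apply/eqP; rewrite eq_le h d0.
have f_inj : injective f.
  move=> i j; case: (split_ordP i) => i' ->; case: (split_ordP j) => j' ->.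
  - by rewrite !fl => /enum_val_inj ->.
  - by move=> e; have := dl i'; rewrite e dr ltxx.
  - by move=> e; have := dl j'; rewrite -e dr ltxx.
  - by rewrite !fr => /enum_val_inj ->.
exists #|P|, #|~: P|, (colsub f U), (\row_i d 0 (f (lshift _ i))); split.
- by rewrite cardsC card_ord.
- apply/matrixP => i j; move/matrixP/(_ (f i) (f j)): UU; rewrite !mxE (inj_eq f_inj) => <-.
  by apply: eq_bigr => k _; rewrite !mxE.
- by move=> i; rewrite mxE.
have -> : (colsub f U)^T *m S *m colsub f U = mxsub f f (U^T *m S *m U).
  apply/matrixP => i j; rewrite !mxE; apply: eq_bigr => k _; rewrite !mxE; congr (_ * _).
  by apply: eq_bigr => l _; rewrite !mxE.
rewrite US; apply/matrixP => i j.
case: (split_ordP i) => i' ->; case: (split_ordP j) => j' ->;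
  rewrite ?block_mxEul ?block_mxEur ?block_mxEdl ?block_mxEdr !mxE (inj_eq f_inj) ?dr ?mul0rn //.
all: by rewrite ?(inj_eq (@lshift_inj _ _)) ?eq_lrshift.
Qed.

End Spectral.

(** * Gaps under reformulation *)

Section Gap.
Variable R : rcfType.

Lemma psd_diag_ge0 n (Z : 'M[R]_n) i : psd Z -> 0 <= Z i i.
Proof.
move=> pZ; have := psd_qtr (delta_mx i 0 : 'cV[R]_n) pZ.
by rewrite /qtr /btr trace_mx11 -mulmxA -colE trmx_delta -rowE !mxE.
Qed.

Lemma psd_diag_eq0 n (Z : 'M[R]_n) i j : psd Z -> Z j j = 0 -> Z i j = 0 /\ Z j i = 0.
Proof.
move=> pZ Zj; have [sZ _] := pZ.
have : Z *m (delta_mx j 0 : 'cV[R]_n) = 0.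
  apply: psd_form0 => //.
  by rewrite /qtr /btr trace_mx11 -mulmxA -colE trmx_delta -rowE !mxE.
rewrite -colE => /matrixP/(_ i 0); rewrite !mxE => Zij; split=> //.
by rewrite -Zij -[in LHS]sZ mxE.
Qed.

Definition gap m n (d : sdp_data R m n) : Prop :=
  let: (A, B, c) := d in val_P_lt_val_D A B c.

(** The constant [k] absorbs the common shift of both objectives when a multiple of some [A j] is
    added to [B]. *)
Lemma gap_transfer m n (A A' : 'I_m -> 'M[R]_n) (B B' : 'M[R]_n) (c c' : 'I_m -> R) (k : R) :
  (forall x, primal_feasible A B x ->
     exists2 y, primal_feasible A' B' y & primal_obj c x = primal_obj c' y + k) ->
  (forall Y, dual_feasible A c Y ->
     exists2 Z, dual_feasible A' c' Z & mdot B Y = mdot B' Z + k) ->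
  gap (A', B', c') -> gap (A, B, c).
Proof.
move=> hP hD [a [b [ab [ha hb]]]]; exists (a + k), (b + k); split; first by rewrite ltrD2r.
split=> [x /hP[y /ha ya ->]|Y /hD[Z /hb Zb ->]]; by rewrite lerD2r.
Qed.

(** Reading the objective as a linear combination in [R^o] lets the summation lemmas below serve for
    the matrices and the objective alike. *)
Lemma primal_obj_comb m (c x : 'I_m -> R) :
  primal_obj c x = \sum_i x i *: (c i : R^o).
Proof. by apply: eq_bigr => i _; rewrite mulrC. Qed.

Lemma sum_shift m (V : lmodType R) (F : 'I_m -> V) (x : 'I_m -> R) j lam :
  \sum_k (if k == j then x k + lam else x k) *: F k = \sum_k x k *: F k + lam *: F j.
Proof.
rewrite (bigD1 j) //= eqxx [in RHS](bigD1 j) //= scalerDl -!addrA; congr (_ + _).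
rewrite addrC; congr (_ + _); apply: eq_bigr => k kj; by rewrite (negPf kj).
Qed.

Lemma sum_swap m (V : lmodType R) (F : 'I_m -> V) (x : 'I_m -> R) i j : i != j ->
  \sum_k (if k == i then x j else if k == j then x i else x k) *:
         (if k == i then F j else if k == j then F i else F k)
  = \sum_k x k *: F k.
Proof.
move=> ij; rewrite (bigD1 i) // (bigD1 j) /= 1?eq_sym // [RHS](bigD1 j) // (bigD1 i) //=.
rewrite !eqxx [j == i]eq_sym (negPf ij); congr (_ + (_ + _)).
rewrite (eq_bigl (fun k => (k != j) && (k != i))) => [|k]; last by rewrite andbC.
by apply: eq_bigr => k /andP[/negPf-> /negPf->].
Qed.

Lemma sum_comb m (V : lmodType R) (F : 'I_m -> V) (x : 'I_m -> R) i j lam mu :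
  j != i -> lam != 0 ->
  \sum_k (if k == i then x i / lam else if k == j then x j - mu * (x i / lam) else x k) *:
         (if k == i then lam *: F i + mu *: F j else F k)
  = \sum_k x k *: F k.
Proof.
move=> ji l0; rewrite (bigD1 i) // (bigD1 j) //= [RHS](bigD1 i) // (bigD1 j) //=.
rewrite !eqxx (negPf ji) scalerDr !scalerA divfK // -!addrA; congr (_ + _).
rewrite addrA -scalerDl; congr (_ *: _ + _); first by ring.
by apply: eq_bigr => k /andP[/negPf-> /negPf->].
Qed.

Lemma mdotDl n (S T Y : 'M[R]_n) : mdot (S + T) Y = mdot S Y + mdot T Y.
Proof. by rewrite /mdot mulmxDl mxtraceD. Qed.

Lemma mdotZl n a (S Y : 'M[R]_n) : mdot (a *: S) Y = a * mdot S Y.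
Proof. by rewrite /mdot -scalemxAl mxtraceZ. Qed.

Lemma gap_reform_step m n (d d' : sdp_data R m n) : reform_step d d' -> gap d' -> gap d.
Proof.
case.
- move=> A B c j lam _; apply: (@gap_transfer _ _ _ _ _ _ _ _ (- (lam * c j))).
    move=> x px; exists (fun k => if k == j then x k + lam else x k).
      rewrite /primal_feasible /psd_le /lin_comb sum_shift.
      by rewrite opprD addrACA subrr addr0.
    by rewrite !primal_obj_comb sum_shift /= addrK.
  move=> Y dY; exists Y => //; have [_ YA] := dY.
  by rewrite mdotDl mdotZl YA addrK.
- move=> A B c i j ij; apply: (@gap_transfer _ _ _ _ _ _ _ _ 0).
    move=> x px; exists (fun k => if k == i then x j else if k == j then x i else x k).
      by rewrite /primal_feasible /psd_le /lin_comb sum_swap.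
    by rewrite addr0 !primal_obj_comb (@sum_swap _ R^o).
  move=> Y [pY YA]; exists Y; last by rewrite addr0.
  by split=> // k; case: ifP => // _; case: ifP.
- move=> A B c i j lam mu ji l0; apply: (@gap_transfer _ _ _ _ _ _ _ _ 0).
    move=> x px; exists (fun k => if k == i then x i / lam
        else if k == j then x j - mu * (x i / lam) else x k).
      by rewrite /primal_feasible /psd_le /lin_comb sum_comb.
    by rewrite addr0 !primal_obj_comb (@sum_comb _ R^o).
  move=> Y [pY YA]; exists Y; last by rewrite addr0.
  by split=> // k; case: ifP => // _; rewrite mdotDl !mdotZl !YA.
- move=> A B c T uT; apply: (@gap_transfer _ _ _ _ _ _ _ _ 0).
    move=> x px; exists x; last by rewrite addr0.
    rewrite /primal_feasible /psd_le.
    have -> : T^T *m B *m T - lin_comb (fun k => T^T *m A k *m T) x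
        = T^T *m (B - lin_comb A x) *m T; last exact: psd_congr.
      rewrite mulmxBr mulmxBl /lin_comb mulmx_sumr mulmx_suml; congr (_ - _).
      by apply: eq_bigr => k _; rewrite -scalemxAr -scalemxAl.
  have dotE (S Y : 'M[R]_n) : mdot (T^T *m S *m T) (invmx T *m Y *m (invmx T)^T) = mdot S Y.
    rewrite /mdot -!mulmxA mxtrace_mulC [T *m (invmx T *m _)]mulmxA mulmxV // mul1mx.
    by rewrite -!mulmxA -trmx_mul mulmxV // trmx1 mulmx1.
  move=> Y [pY YA]; exists (invmx T *m Y *m (invmx T)^T); last by rewrite addr0 dotE.
  split=> [|k]; last by rewrite dotE.
  by have := psd_congr (invmx T)^T pY; rewrite trmxK.
Qed.

Lemma gap_reformulation m n (d d' : sdp_data R m n) : reformulation d d' -> gap d' -> gap d.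
Proof. by elim=> // d1 d2 d3 s _ IH /IH; exact: gap_reform_step s. Qed.

Lemma sum2 (V : nmodType) (F : 'I_2 -> V) : \sum_k F k = F i1 + F i2.
Proof. by rewrite big_ord_recl big_ord1; congr (_ + F _); apply: val_inj. Qed.

(** Primal side: a slack has a zero diagonal entry at [j0], so its entry at [(i0, j0)], a nonzero
    multiple of [x i2], vanishes and the value is 0. Dual side: [A1 . Y = 0] kills the rows of [Y]
    in the first block, after which only diagonal entries contribute to [A2 . Y], and those past [r]
    contribute at most 0. *)
Lemma gap_of_form n r (d : sdp_data R 2 n) : gap_form r d -> gap d.
Proof.
case: d => -[A B] c [p [s [pr [rsn [hB [hA1 [hpos [[i0 [j0 [i0I [j0I Mij]]]]
  [h22 [h23 [h24 [h33 [h34 [h44 [c1 c2]]]]]]]]]]]]]]].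
(* [K] is positive and bounds every diagonal entry of [A i2], so that [c i2 <= K * mdot B Y] for
   dual feasible [Y]. *)
pose K := 1 + \sum_i `|A i2 i i|.
have K0 : 0 < K by rewrite ltr_wpDr // sumr_ge0.
exists 0, (c i2 / K); split; first by rewrite divr_gt0.
split=> [x px|Y [pY YA]].
  rewrite /primal_obj sum2 c1 mul0r add0r.
  suff -> : x i2 = 0 by rewrite mulr0.
  move: px; rewrite /primal_feasible /psd_le /lin_comb sum2 hB => pZ.
  have j0r : (j0 < r)%N = false by move: j0I; rewrite /in_blk; lia.
  have ij0 : (i0 == j0) = false.
    by apply/eqP => e; move: i0I j0I; rewrite e /in_blk; lia.
  have [e _] := h44 j0 j0 j0I j0I.
  have j1 : in_blk 0 p j0 = false by move: j0I; rewrite /in_blk; lia.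
  have [] := @psd_diag_eq0 _ _ i0 j0 pZ; rewrite !mxE.
    by rewrite e hA1 j1 andbF j0r andbF !mulr0 addr0 subr0.
  have ij0' : (nat_of_ord i0 == nat_of_ord j0) = false := ij0.
  rewrite hA1 ij0 ij0' /= ?mulr0n mulr0 add0r add0r => /eqP; rewrite oppr_eq0 mulf_eq0 (negPf Mij) orbF.
  by move=> /eqP.
have Yd i : 0 <= Y i i by exact: psd_diag_ge0.
have Y1 : forall i, in_blk 0 p i -> Y i i = 0.
  have := YA i1; rewrite c1 /mdot /mxtrace.
  rewrite (eq_bigr (fun i => A i1 i i * Y i i)) => [|i _]; last first.
    rewrite mxE (bigD1 i) //= big1 ?addr0 // => k ki.
    by rewrite hA1 eq_sym (negPf ki) mul0r.
  move=> /eqP; rewrite psumr_eq0 => [/allP e i iI|i _]; last first.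
    by rewrite hA1 eqxx /=; case: ifP => [/hpos h|_]; rewrite ?mul0r // mulr_ge0 // ltW.
  have := e i (mem_index_enum i); rewrite /= mulf_eq0 => /orP[|/eqP //].
  by rewrite gt_eqF // hpos.
rewrite ler_pdivrMr //; have := YA i2; rewrite /mdot /mxtrace => <-.
rewrite mulr_suml ler_sum // => i _.
rewrite mxE (bigD1 i) //= big1 ?addr0 => [|k ki]; last first.
  have [iI|i1F] := boolP (in_blk 0 p i).
    by have [-> _] := psd_diag_eq0 k pY (Y1 i iI); rewrite mulr0.
  have [kI|k1F] := boolP (in_blk 0 p k).
    by have [_ ->] := psd_diag_eq0 i pY (Y1 k kI); rewrite mulr0.
  suff -> : A i2 i k = 0 by rewrite mul0r.
  have blk (u : 'I_n) : ~~ in_blk 0 p u ->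
      [\/ in_blk p r u, in_blk r (r + s) u | in_blk (r + s) n u].
    have := ltn_ord u; rewrite /in_blk => h1 h2.
    have [?|?] := ltnP u r; first by apply: Or31; lia.
    by have [?|?] := ltnP u (r + s); [apply: Or32|apply: Or33]; lia.
  case: (blk i i1F) => Hi; case: (blk k k1F) => Hk.
  - by apply: h22 => //; rewrite eq_sym.
  - by case: (h23 i k Hi Hk).
  - by case: (h24 i k Hi Hk).
  - by case: (h23 k i Hk Hi).
  - by rewrite h33 // eq_sym (negPf ki).
  - by case: (h34 i k Hi Hk).
  - by case: (h24 k i Hk Hi).
  - by case: (h34 k i Hk Hi).
  - by case: (h44 i k Hi Hk).
rewrite [X in _ <= X * _]mxE (bigD1 i) //= hB big1 ?addr0 => [|k ki]; last first.
  rewrite mxE (_ : (_ == _) = false) ?mul0r //.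
  by rewrite eq_sym; exact: negPf ki.
rewrite mxE eqxx /=.
have AK : A i2 i i <= K.
  apply: le_trans (ler_norm _) _; rewrite /K (bigD1 i) //= addrCA lerDl.
  by rewrite addr_ge0 // sumr_ge0.
have [ir|ri] := ltnP i r; first by rewrite mul1r mulrC ler_wpM2l.
rewrite !mul0r; have [irs|rsi] := ltnP i (r + s).
  by rewrite h33 ?eqxx ?mulN1r ?oppr_le0 // /in_blk ri irs.
have i4 : in_blk (r + s) n i by rewrite /in_blk rsi ltn_ord.
by have [-> _] := h44 i i i4 i4; rewrite mul0r.
Qed.

End Gap.

(** * Block normal form *)

Section NormalForm.
Variable R : rcfType.

(** Both sides of the gap for the objective [(0, 1)], in a form stable under congruence. The third
    clause is the dual bound on rank one solutions, made homogeneous in [w]. *)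
Definition gap_pencil n (B A1 A2 : 'M[R]_n) (a b : R) :=
  [/\ psd A1, symmetric_mx A2,
      forall w : 'cV[R]_n, A1 *m w = 0 -> b * qtr A2 w <= qtr B w &
      forall x1 x2, psd (B - x1 *: A1 - x2 *: A2) -> x2 <= a].

Lemma gap_pencil_congr n (B A1 A2 T : 'M[R]_n) a b : T \in unitmx ->
  gap_pencil B A1 A2 a b ->
  gap_pencil (T^T *m B *m T) (T^T *m A1 *m T) (T^T *m A2 *m T) a b.
Proof.
move=> uT [pA1 sA2 hD hP]; split; first exact: psd_congr.
- exact: symmetric_congr.
- move=> w h; rewrite !qtr_congr; apply: hD.
  have := congr1 (mulmx (invmx T)^T) h.
  by rewrite !mulmxA -trmx_mul mulmxV // trmx1 mul1mx mulmx0 -mulmxA.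
- move=> x1 x2 pS; apply: (hP x1); have := psd_congr (invmx T) pS.
  rewrite !mulmxBr !mulmxBl -!scalemxAr -!scalemxAl.
  have E (S : 'M[R]_n) : (invmx T)^T *m (T^T *m S *m T) *m invmx T = S.
    by rewrite !mulmxA -trmx_mul mulmxV // trmx1 mul1mx -mulmxA mulmxV // mulmx1.
  by rewrite !E.
Qed.

(** Spectral theorem followed by scaling with inverse square roots. The left inverse [W] records the
    invertibility of [V], whose two dimensions are equal only propositionally. *)
Lemma nsd_normal k (S : 'M[R]_k) : psd (- S) ->
  exists s l (V : 'M[R]_(k, s + l)) (W : 'M[R]_(s + l, k)),
    [/\ (s + l)%N = k, W *m V = 1%:M & V^T *m S *m V = block_mx (- 1%:M) 0 0 0].
Proof.
move=> /psd_spectral [s [l [U [d [e UU d0 US]]]]].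
pose f := diag_mx (\row_i (Num.sqrt (d 0 i))^-1).
pose g := diag_mx (\row_i Num.sqrt (d 0 i)).
pose D := block_mx f 0 0 (1%:M : 'M[R]_l).
have s0 i : Num.sqrt (d 0 i) != 0 by rewrite lt0r_neq0 // sqrtr_gt0.
exists s, l, (U *m D), (block_mx g 0 0 1%:M *m U^T); split=> //.
  rewrite -!mulmxA [U^T *m _]mulmxA UU mul1mx mulmx_block.
  rewrite !(mulmx0, mul0mx, addr0, add0r, mulmx1) mulmx_diag scalar_mx_block.
  congr block_mx; rewrite -diag_const_mx; congr diag_mx; apply/rowP => i.
  by rewrite !mxE divff.
move: US; rewrite mulmxN mulNmx => /(congr1 -%R); rewrite opprK => US.
rewrite trmx_mul -!mulmxA [S *m _]mulmxA [U^T *m _]mulmxA [U^T *m _]mulmxA US.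
rewrite opp_block_mx !oppr0 tr_block_mx tr_diag_mx trmx1 !trmx0 !mulmx_block.
rewrite !(mulmx0, mul0mx, addr0, add0r, mulmx1); congr block_mx.
rewrite mulNmx mulmxN !mulmx_diag -diag_const_mx; congr (- diag_mx _); apply/rowP => i.
rewrite !mxE; have e2 := sqr_sqrtr (ltW (d0 i)); have := s0 i.
by move: e2; set t := Num.sqrt _ => <- t0; field.
Qed.

Lemma qtr_block n1 n2 m (P : 'M[R]_n1) (Q : 'M[R]_(n1, n2)) (Q' : 'M[R]_(n2, n1))
    (S : 'M[R]_n2) (u : 'M[R]_(n1, m)) (v : 'M[R]_(n2, m)) :
  symmetric_mx (block_mx P Q Q' S) ->
  qtr (block_mx P Q Q' S) (col_mx u v) = qtr P u + 2 * \tr (u^T *m Q *m v) + qtr S v.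
Proof.
rewrite /symmetric_mx tr_block_mx => /eq_block_mx[_ _ <- _].
rewrite /qtr /btr -!mulmxA mul_block_col tr_col_mx mul_row_col !mulmxDr !mxtraceD.
have -> : \tr (v^T *m (Q^T *m u)) = \tr (u^T *m (Q *m v)).
  by rewrite -mxtrace_tr !trmx_mul !trmxK mulmxA.
by ring.
Qed.

Lemma symmetric_block n1 n2 (P : 'M[R]_n1) (Q : 'M[R]_(n1, n2)) (Q' : 'M[R]_(n2, n1))
    (S : 'M[R]_n2) :
  symmetric_mx (block_mx P Q Q' S) -> [/\ symmetric_mx P, Q' = Q^T & symmetric_mx S].
Proof. by rewrite /symmetric_mx tr_block_mx => /eq_block_mx[? _ <- ?]. Qed.

Lemma gap_blocks p q s l (d : 'rV[R]_p) (sg : 'rV[R]_q)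
    Y11 Y12 Y21 (Y13 : 'M[R]_(p, s)) (M : 'M[R]_(p, l)) (Y24 : 'M[R]_(q, l)) Ydl a b :
  let A1 := block_mx (block_mx (diag_mx d) 0 0 0) 0 0 0 : 'M[R]_((p + q) + (s + l)) in
  let A2 := block_mx (block_mx Y11 Y12 Y21 (diag_mx sg)) (block_mx Y13 M 0 Y24) Ydl
                     (block_mx (- 1%:M) 0 0 0) in
  (forall i, 0 < d 0 i) -> 0 <= a -> a < b ->
  gap_pencil (pid_mx (p + q)) A1 A2 a b -> Y24 = 0 /\ M != 0.
Proof.
move=> A1 A2 d0 a0 ab [pA1 sA2 hD hP].
have b0 : 0 < b by apply: le_lt_trans ab.
have [sul _ sdr] := symmetric_block sA2.
have sB : symmetric_mx (pid_mx (p + q) : 'M[R]_((p + q) + (s + l))) by rewrite /symmetric_mx tr_pid_mx.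
have A1w (u1 : 'cV[R]_p) u2 v : A1 *m col_mx (col_mx u1 u2) v = col_mx (col_mx (diag_mx d *m u1) 0) 0.
  by rewrite !mul_block_col !mul0mx !addr0.
have qB (u : 'cV[R]_(p + q)) (v : 'cV[R]_(s + l)) : qtr (pid_mx (p + q)) (col_mx u v) = \tr (u^T *m u).
  move: sB; rewrite pid_mx_block => sB; rewrite qtr_block // /qtr /btr.
  by rewrite !mulmx0 !mul0mx !mxtrace0 mulr0 !addr0 mulmx1.
have qA2 (u2 : 'cV[R]_q) (u3 : 'cV[R]_s) (u4 : 'cV[R]_l) :
    qtr A2 (col_mx (col_mx 0 u2) (col_mx u3 u4)) =
    qtr (diag_mx sg) u2 + 2 * \tr (u2^T *m Y24 *m u4) - \tr (u3^T *m u3).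
  rewrite qtr_block // !qtr_block // tr_col_mx mul_row_block mul_row_col.
  rewrite /qtr /btr !(trmx0, mulmx0, mul0mx, addr0, add0r, mulr0, mxtrace0).
  by rewrite mulmxN mulmx1 mulNmx linearN.
have hD' (u2 : 'cV[R]_q) (u3 : 'cV[R]_s) (u4 : 'cV[R]_l) : b * qtr A2 (col_mx (col_mx 0 u2) (col_mx u3 u4)) <= \tr (u2^T *m u2).
  have A1w0 : A1 *m col_mx (col_mx 0 u2) (col_mx u3 u4) = 0.
    by rewrite A1w mulmx0 !col_mx0.
  by have := hD _ A1w0; rewrite qB tr_col_mx mul_row_col trmx0 mul0mx add0r.
have Y24_0 : Y24 = 0.
  apply/matrixP => i j; rewrite [RHS]mxE.
  pose y := Y24 i j; apply/eqP/negPn/negP => y0.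
  pose sgi := qtr (diag_mx sg) (delta_mx i 0 : 'cV[R]_q).
  (* The multiple of [delta_mx j 0] is chosen so that [b] times the form of [A2] equals 2, while the
     form of [B] equals 1. *)
  have := hD' (delta_mx i 0) 0 (((2 - b * sgi) / (2 * b * y)) *: delta_mx j 0).
  have trY : \tr ((delta_mx i 0 : 'cV[R]_q)^T *m Y24 *m (delta_mx j 0 : 'cV[R]_l)) = y.
    by rewrite trace_mx11 trmx_delta -rowE -colE !mxE.
  rewrite qA2 -/sgi -scalemxAr mxtraceZ trY trmx0 mul0mx mxtrace0 subr0.
  rewrite trmx_delta mul_delta_mx trace_mx11 mxE !eqxx /=.
  have -> : b * (sgi + 2 * ((2 - b * sgi) / (2 * b * y) * y)) = 2.
    by field; rewrite y0 lt0r_neq0.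
  by move=> h; have : 2 <= 1 :> R := h; lra.
split=> //; apply/eqP => M0.
(* Suppose [M = 0]. On the kernel of [A1] the form of [C = x A2 - B] is nonpositive, and it vanishes
   only on vectors of the last block, which [C] then annihilates. Dominating [C] by a multiple of
   [A1] yields a primal point with [x2 = x > a]. *)
pose x := (a + b) / 2.
have xa : a < x by rewrite /x; lra.
have xb : x < b by rewrite /x; lra.
have x0 : 0 < x by apply: le_lt_trans xa.
pose C := x *: A2 - pid_mx (p + q).
have sC : symmetric_mx C by have := symmetric_lin x (-1) sA2 sB; rewrite scaleN1r.
have [w Jw|t ht] := psd_dominates pA1 sC.
  rewrite -[w]vsubmxK; move: Jw; rewrite -[in X in X -> _](vsubmxK w).
  move: (usubmx w) (dsubmx w) => u v; rewrite -[u]vsubmxK -[v]vsubmxK.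
  move: (usubmx u) (dsubmx u) (usubmx v) (dsubmx v) => u1 u2 u3 u4.
  rewrite A1w -[X in _ = X -> _](@col_mx0 _ (p + q)) => /eq_col_mx[+ _].
  rewrite -[X in _ = X -> _](@col_mx0 _ p) => /eq_col_mx[du1 _].
  have -> : u1 = 0.
    apply/matrixP => i j; move/matrixP/(_ i j): du1; rewrite mul_diag_mx !mxE.
    by move/eqP; rewrite mulf_eq0 gt_eqF //= => /eqP.
  have qC : qtr C (col_mx (col_mx 0 u2) (col_mx u3 u4)) =
      x * qtr (diag_mx sg) u2 - x * \tr (u3^T *m u3) - \tr (u2^T *m u2).
    rewrite qtrDm qtrZm qtrNm qA2 qB tr_col_mx mul_row_col trmx0 mul0mx add0r Y24_0.
    by rewrite mulmx0 mul0mx mxtrace0; ring.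
  have := hD' u2 0 u4; rewrite qA2 Y24_0 mulmx0 mul0mx trmx0 mul0mx mxtrace0 mulr0 addr0 subr0.
  have := tr_selfmul_ge0 u2; have := tr_selfmul_ge0 u3; rewrite qC.
  set U3 := \tr (u3^T *m u3); set U2 := \tr (u2^T *m u2); set S2 := qtr _ u2 => U30 U20 hS.
  have xS : x * S2 <= x / b * U2.
    by rewrite -mulrA ler_pM2l // mulrC ler_pdivlMr // mulrC.
  have xb1 : x / b < 1 by rewrite ltr_pdivrMr // mul1r.
  have xU : 0 <= x * U3 by rewrite mulr_ge0 // ltW.
  have xU2 : 0 <= (1 - x / b) * U2 by rewrite mulr_ge0 // subr_ge0 ltW.
  split=> [|e]; first by lra.
  have U2_0 : U2 = 0.
    have /eqP : (1 - x / b) * U2 = 0 by lra.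
    by rewrite mulf_eq0 subr_eq0 gt_eqF //= => /eqP.
  have U3_0 : U3 = 0.
    have /eqP : x * U3 = 0 by nra.
    by rewrite mulf_eq0 gt_eqF //= => /eqP.
  rewrite (tr_selfmul_eq0 U2_0) (tr_selfmul_eq0 U3_0) mulmxBl -scalemxAl pid_mx_block.
  by rewrite /A2 M0 Y24_0 !(mul_block_col, col_mx0, mulmx0, mul0mx, addr0, add0r) scaler0 subr0.
have /hP : psd (pid_mx (p + q) - (- t) *: A1 - x *: A2).
  apply/psdE; split.
    have [sA1 _] := pA1.
    have := symmetric_lin 1 1 (symmetric_lin 1 t sB sA1) (symmetric_lin (- x) 0 sA2 sA2).
    by rewrite !scale1r scale0r addr0 scaleNr scaleNr opprK.
  move=> w; have := ht w.
  by rewrite /C !qtrDm !qtrNm !qtrZm; lra.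
by rewrite leNgt xa.
Qed.

End NormalForm.

(** * Assembling the congruences into the normal form *)

Section Assembly.
Variable R : rcfType.

Lemma gap_form_blocks p q s l (d : 'rV[R]_p) (sg : 'rV[R]_q)
    Y11 Y12 Y21 (Y13 : 'M[R]_(p, s)) (M : 'M[R]_(p, l)) Ydl
    (A : 'I_2 -> 'M[R]_((p + q) + (s + l))) c :
  A i1 = block_mx (block_mx (diag_mx d) 0 0 0) 0 0 0 ->
  A i2 = block_mx (block_mx Y11 Y12 Y21 (diag_mx sg)) (block_mx Y13 M 0 0) Ydl
                  (block_mx (- 1%:M) 0 0 0) ->
  symmetric_mx (A i2) -> (forall i, 0 < d 0 i) -> M != 0 -> c i1 = 0 -> 0 < c i2 ->
  gap_form (p + q) (A, pid_mx (p + q), c).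
Proof.
move=> A1E A2E sA2 d0 M0 c1 c2.
have A2C i j : A i2 i j = A i2 j i by rewrite -[in LHS]sA2 mxE.
pose o1 (i : 'I_p) : 'I_((p + q) + (s + l)) := lshift _ (lshift _ i).
pose o2 (i : 'I_q) : 'I_((p + q) + (s + l)) := lshift _ (rshift _ i).
pose o3 (i : 'I_s) : 'I_((p + q) + (s + l)) := rshift _ (lshift _ i).
pose o4 (i : 'I_l) : 'I_((p + q) + (s + l)) := rshift _ (rshift _ i).
have blk1 i : in_blk 0 p i -> exists i', i = o1 i'.
  case: (split_ordP i) => j ->; case: (split_ordP j) => k ->; rewrite /in_blk /= => h;
    by [exists k | have := ltn_ord k; lia].
have blk2 i : in_blk p (p + q) i -> exists i', i = o2 i'.
  case: (split_ordP i) => j ->; case: (split_ordP j) => k ->; rewrite /in_blk /= => h;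
    by [exists k | have := ltn_ord k; lia].
have blk3 i : in_blk (p + q) (p + q + s) i -> exists i', i = o3 i'.
  case: (split_ordP i) => j ->; case: (split_ordP j) => k ->; rewrite /in_blk /= => h;
    by [exists k | have := ltn_ord k; lia].
have blk4 i : in_blk (p + q + s) (p + q + (s + l)) i -> exists i', i = o4 i'.
  case: (split_ordP i) => j ->; case: (split_ordP j) => k ->; rewrite /in_blk /= => h;
    by [exists k | have := ltn_ord k; lia].
have zero i j : A i2 i j = 0 -> A i2 i j = 0 /\ A i2 j i = 0 by rewrite (A2C j).
pose D : 'rV[R]_((p + q) + (s + l)) := row_mx (row_mx d 0) 0.
have A1D : A i1 = diag_mx D.
  by rewrite A1E !diag_mx_row; congr (block_mx (block_mx _ _ _ _) _ _ _);
    apply/matrixP => ? ?; rewrite !mxE mul0rn.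
have A1ij i j : A i1 i j = D 0 i *+ (i == j) by rewrite A1D mxE.
exists p, s; split; [by rewrite leq_addr|split; first by rewrite leq_add2l leq_addr].
split=> //; split.
  move=> i j; rewrite !A1ij; case: eqVneq => //= _; rewrite eqxx mulr1n.
  case: ifP => // iF; rewrite /D.
  case: (split_ordP i) iF => k ->; last by rewrite row_mxEr mxE.
  rewrite row_mxEl; case: (split_ordP k) => k' ->; last by rewrite row_mxEr mxE.
  by rewrite /in_blk /= ltn_ord.
split; first by move=> i /blk1[i' ->]; rewrite A1ij eqxx mulr1n /D !row_mxEl.
split.
  apply: NNPP => h; move/eqP: M0; apply; apply/matrixP => i j; rewrite [RHS]mxE.
  apply/eqP/negPn/negP => Mij; apply: h; exists (o1 i), (o4 j).
  rewrite A2E block_mxEur block_mxEur; split; last split=> //.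
    by rewrite /in_blk /= ltn_ord.
  by rewrite /in_blk /=; have := ltn_ord j; lia.
split.
  move=> i j /blk2[i' ->] /blk2[j' ->] ij; rewrite A2E block_mxEul block_mxEdr mxE.
  rewrite (_ : (i' == j') = false) //; apply: contraNF ij => /eqP ->; exact: eqxx.
split; first by move=> i j /blk2[i' ->] /blk3[j' ->]; apply: zero; rewrite A2E block_mxEur block_mxEdl mxE.
split; first by move=> i j /blk2[i' ->] /blk4[j' ->]; apply: zero; rewrite A2E block_mxEur block_mxEdr mxE.
split.
  move=> i j /blk3[i' ->] /blk3[j' ->]; rewrite A2E block_mxEdr block_mxEul !mxE.
  rewrite /o3 (inj_eq (@rshift_inj _ _)) (inj_eq (@lshift_inj _ _)).
  by case: eqVneq; rewrite ?oppr0.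
split; first by move=> i j /blk3[i' ->] /blk4[j' ->]; apply: zero; rewrite A2E block_mxEdr block_mxEur mxE.
split; first by move=> i j /blk4[i' ->] /blk4[j' ->]; apply: zero; rewrite A2E !block_mxEdr mxE.
by [].
Qed.

Lemma block_unit n1 n2 (P : 'M[R]_n1) (Q : 'M[R]_(n2, n1)) (S : 'M[R]_n2) :
  P \in unitmx -> S \in unitmx -> block_mx P 0 Q S \in unitmx.
Proof. by move=> uP uS; rewrite unitmxE det_lblock unitrM -!unitmxE uP. Qed.

(** The block [- 1%:M] is a pivot: adding combinations of the third coordinates to the second ones
    clears [X23] and turns [X22] into the Schur complement [X22 + X23 *m X23^T], which an orthogonal
    [Q] diagonalises. *)
Lemma gap_form_of_blocks p q s l (d : 'rV[R]_p) (A1 A2 : 'M[R]_((p + q) + (s + l))) a b :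
  A1 = block_mx (block_mx (diag_mx d) 0 0 0) 0 0 0 ->
  drsubmx A2 = block_mx (- 1%:M) 0 0 0 ->
  (forall i, 0 < d 0 i) -> 0 <= a -> a < b ->
  gap_pencil (pid_mx (p + q)) A1 A2 a b ->
  exists T, [/\ T \in unitmx, T^T *m pid_mx (p + q) *m T = pid_mx (p + q) &
    forall A c, A i1 = T^T *m A1 *m T -> A i2 = T^T *m A2 *m T ->
      c i1 = 0 -> 0 < c i2 -> gap_form (p + q) (A, pid_mx (p + q), c)].
Proof.
move=> A1E A2dr d0 a0 ab K.
have [_ sA2 _ _] := K.
pose X := ursubmx A2.
pose X23 : 'M_(q, s) := dlsubmx X.
pose X22 : 'M_q := drsubmx (ulsubmx A2).
have A2E : A2 = block_mx (ulsubmx A2) X X^T (block_mx (- 1%:M) 0 0 0).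
  by rewrite -A2dr /X trmx_ursub sA2 submxK.
have sX22 : symmetric_mx X22 by rewrite /symmetric_mx /X22 trmx_drsub trmx_ulsub sA2.
have [Q [sg [QQ QS]]] : exists (Q : 'M[R]_q) (sg : 'rV[R]_q),
    Q^T *m Q = 1%:M /\ Q^T *m (X22 + X23 *m X23^T) *m Q = diag_mx sg.
  apply: spectral; rewrite /symmetric_mx linearD /= trmx_mul trmxK; congr (_ + _).
  exact: sX22.
have uQ : Q \in unitmx by have [] := mulmx1_unit QQ.
pose E : 'M[R]_(s, q) := X23^T *m Q.
(* The first [p + q] rows of [T] are the orthogonal block [diag(1, Q)] followed by zeros, so the
   congruence fixes [B] and [A1]. *)
pose T := block_mx (block_mx 1%:M 0 0 Q) 0 (block_mx 0 E 0 0) 1%:M : 'M[R]_((p + q) + (s + l)).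
have uT : T \in unitmx by rewrite block_unit ?unitmx1 // block_unit ?unitmx1.
have TB : T^T *m pid_mx (p + q) *m T = pid_mx (p + q).
  rewrite pid_mx_block /T !tr_block_mx !(trmx0, trmx1) !mulmx_block.
  rewrite !(mulmx0, mul0mx, addr0, add0r, mulmx1, mul1mx) !mulmx_block.
  by rewrite !(mulmx0, mul0mx, addr0, add0r, mulmx1, mul1mx) QQ -scalar_mx_block.
have TA1 : T^T *m A1 *m T = A1.
  rewrite A1E /T !tr_block_mx !(trmx0, trmx1) !mulmx_block.
  rewrite !(mulmx0, mul0mx, addr0, add0r, mulmx1, mul1mx, block_mx0) !mulmx_block.
  by rewrite !(mulmx0, mul0mx, addr0, add0r, mulmx1, mul1mx, block_mx0).
exists T; split=> // A c; rewrite TA1 => AE1 AE2 c1 c2.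
have := gap_pencil_congr uT K; rewrite TB TA1 => K'.
have [Y11 [Y12 [Y21 [Y13 [M [Y24 [Ydl TA2]]]]]]] :
  exists Y11 Y12 Y21 (Y13 : 'M[R]_(p, s)) (M : 'M[R]_(p, l)) (Y24 : 'M[R]_(q, l)) Ydl,
    T^T *m A2 *m T = block_mx (block_mx Y11 Y12 Y21 (diag_mx sg)) (block_mx Y13 M 0 Y24) Ydl
                     (block_mx (- 1%:M) 0 0 0).
  rewrite -QS A2E -[ulsubmx A2]submxK -[X]submxK -/X22 -/X23 /T.
  rewrite !tr_block_mx !(trmx0, trmx1) !mulmx_block.
  rewrite !(mulmx0, mul0mx, addr0, add0r, mulmx1, mul1mx) !mulmx_block.
  have EE : Q^T *m X23 + E^T *m - 1%:M = 0.
    by rewrite /E trmx_mul trmxK mulmxN mulmx1 subrr.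
  have -> : Q^T *m (X22 + X23 *m X23^T) *m Q = (Q^T *m X22 + E^T *m X23^T) *m Q.
    by rewrite mulmxDr /E trmx_mul trmxK !mulmxA.
  rewrite !(mulmx0, mul0mx, addr0, add0r, mulmx1, mul1mx) !add_block_mx.
  rewrite !(mulmx0, mul0mx, addr0, add0r, mulmx1, mul1mx) EE !mulmx_block !add_block_mx.
  rewrite !(mulmx0, mul0mx, addr0, add0r, mulmx1, mul1mx).
  by do 7!eexists.
have [Y24_0 M0] : Y24 = 0 /\ M != 0.
  by move: K'; rewrite A1E TA2 => K'; exact: gap_blocks K'.
apply: (@gap_form_blocks p q s l d sg Y11 Y12 Y21 Y13 M Ydl) => //.
- by rewrite AE1.
- by rewrite AE2 TA2 Y24_0.
- by rewrite AE2; exact: symmetric_congr.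
Qed.

(** A first congruence [diag(U, V)] diagonalises the leading block of [A1] with [U] orthogonal,
    which preserves [B], and normalises the trailing block of [A2] with [V]. *)
Lemma pencil_normal_form n r (A1 A2 : 'M[R]_n) a b :
  (r <= n)%N -> 0 <= a -> a < b ->
  gap_pencil (pid_mx r) A1 A2 a b -> (forall i j : 'I_n, (r <= j)%N -> A1 i j = 0) ->
  exists T, [/\ T \in unitmx, T^T *m pid_mx r *m T = pid_mx r &
    forall A c, A i1 = T^T *m A1 *m T -> A i2 = T^T *m A2 *m T ->
      c i1 = 0 -> 0 < c i2 -> gap_form r (A, pid_mx r, c)].
Proof.
move=> /subnKC; move: (n - r)%N => k nE; subst n => a0 ab K hA1.
have b0 : 0 < b by apply: le_lt_trans ab.
have [pA1 sA2 hD _] := K; have [sA1 _] := pA1.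
have A1E : A1 = block_mx (ulsubmx A1) 0 0 0.
  have ur : ursubmx A1 = 0 by apply/matrixP => i j; rewrite !mxE hA1 //= leq_addr.
  have dr : drsubmx A1 = 0 by apply/matrixP => i j; rewrite !mxE hA1 //= leq_addr.
  have dl : dlsubmx A1 = 0 by rewrite -[A1]sA1 -trmx_ursub ur trmx0.
  by rewrite -[LHS]submxK ur dr dl.
have pA11 : psd (ulsubmx A1).
  have := psd_congr (col_mx 1%:M 0) pA1.
  by rewrite [in X in psd X]A1E tr_col_mx mul_row_block mul_row_col !(trmx1, trmx0, mulmx0, mul0mx, addr0, mulmx1, mul1mx).
(* Vectors supported past [r] are annihilated by [A1] and by [B], so the dual bound leaves
   [b * qtr A2 <= 0] on them. *)
have pA2dr : psd (- drsubmx A2).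
  apply/psdE; split; first by rewrite /symmetric_mx linearN /= trmx_drsub sA2.
  move=> v; rewrite qtrNm oppr_ge0 -(pmulr_rle0 _ b0).
  have A1v : A1 *m col_mx 0 v = 0 by rewrite A1E mul_block_col !(mulmx0, mul0mx, addr0, col_mx0).
  have := hD _ A1v; rewrite -[in X in X -> _](submxK A2) qtr_block; last by rewrite submxK.
  have sB : symmetric_mx (block_mx 1%:M 0 0 0 : 'M[R]_(r + k)).
    by rewrite -pid_mx_block /symmetric_mx tr_pid_mx.
  rewrite pid_mx_block qtr_block // /qtr /btr.
  by rewrite !(mulmx0, trmx0, mul0mx, mxtrace0, mulr0, addr0, add0r).
have [p [q [U [d [e UU d0 US]]]]] := psd_spectral pA11.
have [s [l [V [W [e' WV VS]]]]] := nsd_normal pA2dr.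
subst r k.
have uU : U \in unitmx by have [] := mulmx1_unit UU.
have uV : V \in unitmx by have [] := mulmx1_unit WV.
pose T0 := block_mx U 0 0 V : 'M[R]_((p + q) + (s + l)).
have uT0 : T0 \in unitmx by rewrite block_unit.
have T0E P Q Q' S : T0^T *m block_mx P Q Q' S *m T0
    = block_mx (U^T *m P *m U) (U^T *m Q *m V) (V^T *m Q' *m U) (V^T *m S *m V).
  by rewrite /T0 tr_block_mx !trmx0 !mulmx_block !(mulmx0, mul0mx, addr0, add0r).
have T0B : T0^T *m pid_mx (p + q) *m T0 = pid_mx (p + q).
  by rewrite pid_mx_block T0E mulmx1 UU !(mulmx0, mul0mx).
have := gap_pencil_congr uT0 K; rewrite T0B => K0.
have T0A1 : T0^T *m A1 *m T0 = block_mx (block_mx (diag_mx d) 0 0 0) 0 0 0.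
  by rewrite A1E T0E US !(mulmx0, mul0mx).
have T0A2 : drsubmx (T0^T *m A2 *m T0) = block_mx (- 1%:M) 0 0 0.
  by rewrite -[A2]submxK T0E block_mxKdr.
have [T [uT TB hT]] := gap_form_of_blocks T0A1 T0A2 d0 a0 ab K0.
exists (T0 *m T); split.
- by rewrite unitmx_mul uT0.
- by rewrite trmx_mul -[RHS]TB -[in RHS]T0B !mulmxA.
- by move=> A c AE1 AE2; apply: hT; rewrite ?AE1 ?AE2 trmx_mul !mulmxA.
Qed.

(* A maximum rank slack [Z] bounds the range of every other slack: adding a psd
   matrix [S] to [Z] can only shrink the kernel. *)
Lemma max_rank_ker n (Z S : 'M[R]_n) :
  psd Z -> psd S -> (\rank (Z + S)%R <= \rank Z)%N ->
  forall x : 'cV[R]_n, Z *m x = 0 -> S *m x = 0.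
Proof.
move=> pZ pS rk x Zx; have [sZ _] := pZ; have [sS _] := pS.
have sub : (kermx (Z + S)%R <= kermx Z)%MS.
  apply/rV_subP => v /sub_kermxP vZS; apply/sub_kermxP.
  have e : (Z + S) *m v^T = 0.
    by have := congr1 trmx vZS; rewrite trmx_mul linearD /= sZ sS trmx0.
  have : qtr Z v^T + qtr S v^T = 0 by rewrite -qtrDm /qtr /btr -mulmxA e mulmx0 mxtrace0.
  have := psd_qtr v^T pZ; have := psd_qtr v^T pS => h1 h2 h3.
  have /(psd_form0 pZ) : qtr Z v^T = 0 by lra.
  by move=> /(congr1 trmx); rewrite trmx_mul trmxK sZ trmx0.
have ker_eq : (kermx Z <= kermx (Z + S)%R)%MS.
  rewrite -(geq_leqif (mxrank_leqif_sup sub)) !mxrank_ker; exact: leq_sub2l rk.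
have : (x^T <= kermx (Z + S)%R)%MS.
  by apply: submx_trans ker_eq; apply/sub_kermxP; have := congr1 trmx Zx; rewrite trmx_mul sZ trmx0.
move=> /sub_kermxP /(congr1 trmx); rewrite trmx_mul trmxK trmx0 linearD /= sZ sS mulmxDl Zx.
by rewrite add0r.
Qed.

End Assembly.

(** * The gap forces the normal form *)

Section Main.
Variable R : rcfType.

Lemma reformulation_trans m n (d1 d2 d3 : sdp_data R m n) :
  reformulation d1 d2 -> reformulation d2 d3 -> reformulation d1 d3.
Proof. by elim=> // e1 e2 e3 s _ IH /IH; exact: Reform_step. Qed.

Lemma reformulation1 m n (d1 d2 : sdp_data R m n) : reform_step d1 d2 -> reformulation d1 d2.
Proof. by move=> s; apply: Reform_step s _; exact: Reform_refl. Qed.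

(* The determinant condition makes the two new constraint matrices span the same
   pencil as the old ones. *)
Lemma normalize_objective n (A : 'I_2 -> 'M[R]_n) B c :
  (c i1 != 0) || (c i2 != 0) ->
  exists A' c' al1 al2 be1 be2, reformulation (A, B, c) (A', B, c') /\
    [/\ A' i1 = al1 *: A i1 + al2 *: A i2, A' i2 = be1 *: A i1 + be2 *: A i2,
        al1 * c i1 + al2 * c i2 = 0, be1 * c i1 + be2 * c i2 = 1 &
        al1 * be2 - al2 * be1 != 0] /\ c' i1 = 0 /\ c' i2 = 1.
Proof.
have i12 : i1 != i2 by [].
have main (A0 : 'I_2 -> 'M[R]_n) c0 : c0 i2 != 0 ->
  exists A' c', reformulation (A0, B, c0) (A', B, c') /\
    [/\ A' i1 = A0 i1 - (c0 i1 / c0 i2) *: A0 i2, A' i2 = (c0 i2)^-1 *: A0 i2,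
        c' i1 = 0 & c' i2 = 1].
  move=> c20; do 2!eexists; split.
    apply: Reform_step.
      by apply: (@RS_comb _ _ _ A0 B c0 i1 i2 1 (- (c0 i1 / c0 i2))); rewrite ?oner_eq0.
    by apply: reformulation1; apply: (@RS_comb _ _ _ _ _ _ i2 i1 (c0 i2)^-1 0); rewrite ?invr_eq0.
  by rewrite /= scale0r addr0 scale1r scaleNr; split=> //; field.
have [c20 _|c20] := boolP (c i2 != 0).
  have [A' [c' [hr [E1 E2 c1 c2]]]] := main A c c20.
  exists A', c', 1, (- (c i1 / c i2)), 0, (c i2)^-1; split=> //; split=> //.
  rewrite E1 E2; split=> //; rewrite ?scale1r ?scaleNr ?scale0r ?add0r //; try by field.
  by rewrite mulr0 subr0 mul1r invr_eq0.
rewrite orbF => c10; move/negPn/eqP: c20 => c20.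
pose A0 := fun k => if k == i1 then A i2 else if k == i2 then A i1 else A k.
pose c0 := fun k => if k == i1 then c i2 else if k == i2 then c i1 else c k.
have c0E : c0 i2 = c i1 by [].
have [|A' [c' [hr [E1 E2 c1 c2]]]] := main A0 c0; first by rewrite c0E.
exists A', c', 0, 1, (c i1)^-1, 0; split.
  by apply: Reform_step hr; apply: RS_swap.
split=> //; rewrite E1 E2 c0E /A0 /c0 !eqxx /= c20; split=> //; try by field.
- by rewrite mul0r scale0r subr0 add0r scale1r.
- by rewrite scale0r addr0.
- by rewrite !mul0r sub0r oppr_eq0 mul1r invr_eq0.
Qed.

Lemma gap_has_form n r (A : 'I_2 -> 'M[R]_n) B c :
  (forall i, symmetric_mx (A i)) -> standing_assumption A B r ->
  val_P_lt_val_D A B c ->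
  exists d' : sdp_data R 2 n, reformulation (A, B, c) d' /\ gap_form r d'.
Proof.
move=> sA [_ [indep [rn [BE [[_ [_ pB]] maxrk]]]]] [a [b [ab [hP hD]]]].
have [sB _] := pB.
have a0 : 0 <= a.
  have /hP : primal_feasible A B (fun=> 0).
    by rewrite /primal_feasible /psd_le /lin_comb sum2 !scale0r addr0 subr0.
  by rewrite /primal_obj sum2 !mulr0 addr0.
have b0 : 0 < b by apply: le_lt_trans ab.
(* With [c = 0] the zero matrix would be dual feasible with value 0, below [b]. *)
have c0 : (c i1 != 0) || (c i2 != 0).
  rewrite -negb_and; apply/negP => /andP[/eqP c1 /eqP c2].
  have /hD : dual_feasible A c 0.
    split=> [|i]; first by have := psd_gram (0 : 'M[R]_n); rewrite mul0mx.
    rewrite /mdot mulmx0 mxtrace0; case: (split_ordP (i : 'I_(1 + 1))) => j ->.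
      by rewrite -c1; congr c; apply: val_inj; rewrite /= (ord1 j).
    by rewrite -c2; congr c; apply: val_inj; rewrite /= (ord1 j).
  by rewrite /mdot mulmx0 mxtrace0 leNgt b0.
have [A' [c' [al1 [al2 [be1 [be2 [hr [[E1 E2 ac bc det] [c1 c2]]]]]]]]] := normalize_objective A B c0.
set J := A' i1 in E1; set C := A' i2 in E2.
have sJ : symmetric_mx J by rewrite E1; exact: symmetric_lin.
have sC : symmetric_mx C by rewrite E2; exact: symmetric_lin.
have combE x1 x2 : exists2 x, lin_comb A x = x1 *: J + x2 *: C & primal_obj c x = x2.
  exists (fun k => if k == i1 then x1 * al1 + x2 * be1 else x1 * al2 + x2 * be2).
    rewrite /lin_comb sum2 /= E1 E2 !scalerDr !scalerA !scalerDl.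
    by rewrite addrACA.
  rewrite /primal_obj sum2 /=.
  have -> : c i1 * (x1 * al1 + x2 * be1) + c i2 * (x1 * al2 + x2 * be2) =
    x1 * (al1 * c i1 + al2 * c i2) + x2 * (be1 * c i1 + be2 * c i2) by ring.
  by rewrite ac bc mulr0 add0r mulr1.
have kP x1 x2 : psd (B - x1 *: J - x2 *: C) -> x2 <= a.
  have [x xE xo] := combE x1 x2; move=> pS; rewrite -xo; apply: hP.
  by rewrite /primal_feasible /psd_le xE opprD addrA.
(* When [qtr C G] is positive, [G *m G^T] divided by it is dual feasible. Several columns are
   allowed because the hypothesis of Finsler's lemma asks for them. *)
have kD m (G : 'M[R]_(n, m)) : qtr J G = 0 -> b * qtr C G <= qtr B G.
  move=> JG; have qB := psd_qtr G pB.
  have [CG|CG] := leP (qtr C G) 0; first by apply: le_trans qB; rewrite pmulr_rle0.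
  rewrite -ler_pdivlMr //.
  pose Y := (qtr C G)^-1 *: (G *m G^T).
  have dotY S : mdot S Y = qtr S G / qtr C G.
    by rewrite /mdot /Y -scalemxAr mxtraceZ -qtr_tr mulrC.
  have dJ : al1 * mdot (A i1) Y + al2 * mdot (A i2) Y = 0.
    by rewrite -!mdotZl -mdotDl -E1 dotY JG mul0r.
  have dC : be1 * mdot (A i1) Y + be2 * mdot (A i2) Y = 1.
    by rewrite -!mdotZl -mdotDl -E2 dotY divff ?lt0r_neq0.
  have [m1 m2] : mdot (A i1) Y = c i1 /\ mdot (A i2) Y = c i2.
    (* Cramer's rule recovers the original dual constraints from the normalised ones. *)
    have e1 : (al1 * be2 - al2 * be1) * (mdot (A i1) Y - c i1) = 0.
      rewrite (_ : _ * _ = be2 * ((al1 * mdot (A i1) Y + al2 * mdot (A i2) Y)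
        - (al1 * c i1 + al2 * c i2)) - al2 * ((be1 * mdot (A i1) Y + be2 * mdot (A i2) Y)
        - (be1 * c i1 + be2 * c i2))); last by ring.
      by rewrite dJ dC ac bc !subrr !mulr0 subr0.
    have e2 : (al1 * be2 - al2 * be1) * (mdot (A i2) Y - c i2) = 0.
      rewrite (_ : _ * _ = al1 * ((be1 * mdot (A i1) Y + be2 * mdot (A i2) Y)
        - (be1 * c i1 + be2 * c i2)) - be1 * ((al1 * mdot (A i1) Y + al2 * mdot (A i2) Y)
        - (al1 * c i1 + al2 * c i2))); last by ring.
      by rewrite dJ dC ac bc !subrr !mulr0 subr0.
    move/eqP: e1; move/eqP: e2; rewrite !mulf_eq0 (negPf det) !subr_eq0 /=.
    by move=> /eqP -> /eqP ->.
  rewrite -dotY; apply: hD; split.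
    have := psd_gram (Num.sqrt ((qtr C G)^-1) *: G).
    by rewrite linearZ /= -scalemxAl -scalemxAr scalerA -expr2 sqr_sqrtr // invr_ge0 ltW.
  move=> i; case: (split_ordP (i : 'I_(1 + 1))) => j ->.
    have -> : lshift 1 j = i1 :> 'I_2 by apply: val_inj; rewrite /= (ord1 j).
    exact: m1.
  have -> : rshift 1 j = i2 :> 'I_2 by apply: val_inj; rewrite /= (ord1 j).
  exact: m2.
(* Strong duality holds when [J] is indefinite: Finsler gives a primal feasible
   point of value [b]. *)
have [sg [sg0 pJ]] : exists sg : R, sg != 0 /\ psd (sg *: J).
  have [[up hup]|noup] := classic (exists u : 'cV[R]_n, 0 < qtr J u); last first.
    exists (-1); rewrite oppr_eq0 oner_eq0; split=> //; apply/psdE; split.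
      by have := symmetric_lin (-1) 0 sJ sJ; rewrite scale0r addr0.
    move=> x; rewrite qtrZm mulN1r oppr_ge0 leNgt; apply/negP => h.
    by apply: noup; exists x.
  have [[un hun]|noun] := classic (exists u : 'cV[R]_n, qtr J u < 0); last first.
    exists 1; rewrite oner_eq0 scale1r; split=> //; apply/psdE; split=> // x.
    by rewrite leNgt; apply/negP => h; apply: noun; exists x.
  have sC' : symmetric_mx (b *: C - B).
    by have := symmetric_lin b (-1) sC sB; rewrite scaleN1r.
  have [|t ht] := finsler sJ sC' hup hun.
    by move=> m G JG; rewrite qtrDm qtrZm qtrNm subr_le0 kD.
  have /kP : psd (B - t *: J - b *: C).
    apply/psdE; split.
      have := symmetric_lin 1 1 (symmetric_lin 1 (- t) sB sJ) (symmetric_lin (- b) 0 sC sC).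
      by rewrite !scale1r scale0r addr0 !scaleNr.
    by move=> w; have := ht w; rewrite !qtrDm !qtrNm !qtrZm; lra.
  by rewrite leNgt ab.
have KP : gap_pencil (pid_mx r) (sg *: J) C a b.
  split=> //.
    move=> w Jw; rewrite -BE; apply: kD; rewrite /qtr /btr -mulmxA.
    have -> : J *m w = sg^-1 *: ((sg *: J) *m w) by rewrite -scalemxAl scalerA mulVf // scale1r.
    by rewrite Jw scaler0 mulmx0 mxtrace0.
  by move=> x1 x2; rewrite -BE scalerA; exact: kP.
have JZ (i j : 'I_n) : (r <= j)%N -> (sg *: J) i j = 0.
  move=> rj; have Bj : B *m (delta_mx j 0 : 'cV[R]_n) = 0.
    rewrite -colE BE; apply/matrixP => k l; rewrite !mxE.
    by case: eqVneq => //= ->; rewrite ltnNge rj.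
  (* [B + sg *: J] is the slack with coefficient [- sg] on [J], so its rank cannot exceed that of
     [B]. *)
  have rk : (\rank (B + sg *: J)%R <= \rank B)%N.
    apply: maxrk; have [x xE _] := combE (- sg) 0; exists x; split.
      by rewrite xE scale0r addr0 scaleNr opprK.
    apply/psdE; split=> [|x']; last by rewrite qtrDm addr_ge0 ?psd_qtr.
    by have := symmetric_lin 1 sg sB sJ; rewrite scale1r.
  have := max_rank_ker pB pJ rk Bj; rewrite -colE => /matrixP/(_ i 0).
  by rewrite mxE [RHS]mxE.
have [T [uT TB hT]] := pencil_normal_form (ltnW rn) a0 ab KP JZ.
do 2!eexists; first apply: reformulation_trans hr _.
  (* With second coefficient 0 the combination step only rescales [A' i1] by [sg]. *)
  apply: Reform_step; first by apply: (@RS_comb _ _ _ A' B c' i1 i2 sg 0).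
  by apply: reformulation1; apply: (@RS_congr _ _ _ _ _ _ T uT).
rewrite BE TB; apply: hT => //=.
- by rewrite scale0r addr0.
- by rewrite c1 mulr0 mul0r addr0.
- by rewrite c2 ltr01.
Qed.

End Main.

Theorem theorem1 (R : rcfType) (n r : nat)
  (A : 'I_2 -> 'M[R]_n) (B : 'M[R]_n) (c : 'I_2 -> R)
  (hAsym : forall i, symmetric_mx (A i)) (hBsym : symmetric_mx B)
  (hstand : standing_assumption A B r) :
  val_P_lt_val_D A B c <->
  exists d' : sdp_data R 2 n, reformulation (A, B, c) d' /\ gap_form r d'.
Proof.
split; first exact: gap_has_form.
by move=> [d' [hr /gap_of_form hg]]; have := gap_reformulation hr hg.
Qed.
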